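(* Let $C_1, C_2$ be positive constants for which the prime-counting bound $C_1 \, n/\ln(n) \le |\mathcal{P}_n| \le C_2 \, n/\ln(n)$ holds (see the context). For $d \in \mathbb{N}$, $\alpha > 0$, positive weights $\boldsymbol{\gamma} = \{\gamma_{\mathfrak{u}}\}_{\mathfrak{u} \subset \mathbb{N}}$ and for each $n \in \mathbb{N}$ satisfying $n \ge \mathrm{e}^{6 C_2} > 34$, with $N = \prod_{p \in \mathcal{P}_n} p$, there exists a vector $\boldsymbol{z} \in \mathbb{Z}_N^d$ which achieves the bound $$ e^{\mathrm{rms}}_{d,\alpha,\boldsymbol{\gamma}}\big(Q^{\mathrm{ran\text{-}pr\text{-}sh}}_{d,n,\boldsymbol{z}}\big) \;\le\; \frac{1}{n^{\lambda + (r-1)/(2r)}} \left( \frac{C_3 \, r \, \ln(n)}{C_1 \, \ln(r+1)} \right)^{1/2} \big(4\, \mu_{d,\alpha,\boldsymbol{\gamma}}(\lambda)\big)^{\lambda} $$ for all $0 < \lambda < \alpha$ and $r \in \mathbb{N}$ with $r \ge 1/(2\lambda)$. The constants $C_1$ and $C_2$ can be taken to satisfy $0.4 < C_1 < 0.5 < C_2 < 0.6$ (cf. the prime-counting bound above), and we then fix $C_3 = 0.792$. Moreover, if $$ \sum_{\substack{\emptyset \neq \mathfrak{u} \subset \mathbb{N} \\ |\mathfrak{u}| < \infty}} \gamma_{\mathfrak{u}}^{1/\lambda} \, (2\zeta(\alpha/\lambda))^{|\mathfrak{u}|} < \infty, $$ where $\zeta$ is the Riemann zeta function, then the upper bound can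 be stated with an absolute constant independent of the dimension.
   Context: Notation: $\mathbb{N} = \{1,2,\ldots\}$, $\mathbb{Z}_m = \{0,1,\ldots,m-1\}$. For an integer $n \ge 2$, $\mathcal{P}_n := \{ n/2 < p \le n : p \text{ prime}\}$. For $\boldsymbol{h} \in \mathbb{Z}^d$, $\mathrm{supp}(\boldsymbol{h}) := \{ j \in \{1,\ldots,d\} : h_j \ne 0\}$. Prime-counting constants: by the prime number theorem, for $n \ge 2$ there exist two positive constants $C_1$ and $C_2$ such that $$ C_1 \, \frac{n}{\ln(n)} \le |\mathcal{P}_n| \le C_2 \, \frac{n}{\ln(n)}. $$ These constants can be taken closer and closer to $0.5$ when $n$ is assumed to be larger; the paper asserts that for $n \ge 20$ one can take $C_1$ and $C_2$ satisfying $0.4 < C_1 < 0.5 < C_2 < 0.6$. Weights: $\boldsymbol{\gamma} = \{\gamma_{\mathfrak{u}}\}_{\mathfrak{u} \subset \mathbb{N}}$ is a family of positive numbers indexed by subsets of $\mathbb{N}$; it does not depend on $d$. For $\alpha>0$ define $$ r_{\alpha,\boldsymbol{\gamma}}(\boldsymbol{h}) := \gamma_{\mathrm{supp}(\boldsymbol{h})}^{-1} \prod_{j \in \mathrm{supp}(\boldsymbol{h})} |h_j|^{\alpha}, \qquad \boldsymbol{h} \in \mathbb{Z}^d. $$ Function space (Korobov space): $\mathcal{H}_{d,\alpha,\boldsymbol{\gamma}}$ is the set of $f \in L_2([0,1]^d)$ with $\|f\|_{d,\alpha,\boldsymbol{\gamma}} < \infty$, where $\|f\|_{d,\alpha,\boldsymbol{\gamma}}^2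 := \sum_{\boldsymbol{h} \in \mathbb{Z}^d} |\hat f(\boldsymbol{h})|^2 \, r_{\alpha,\boldsymbol{\gamma}}^2(\boldsymbol{h})$ and $\hat f(\boldsymbol{h}) := \int_{[0,1]^d} f(\boldsymbol{x}) \, \mathrm{e}^{-2\pi \mathrm{i}\, \boldsymbol{h}\cdot\boldsymbol{x}} \,\mathrm{d}\boldsymbol{x}$. Integral: $I_d(f) := \int_{[0,1]^d} f(\boldsymbol{x}) \,\mathrm{d}\boldsymbol{x}$. Shifted lattice rule: for $m \in \mathbb{N}$, $\boldsymbol{z} \in \mathbb{Z}^d$, $\boldsymbol{\Delta} \in [0,1)^d$, $Q_{d,m,\boldsymbol{z},\boldsymbol{\Delta}}(f) := \frac1m \sum_{k=0}^{m-1} f\big((\boldsymbol{z}k/m + \boldsymbol{\Delta}) \bmod 1\big)$, with mod 1 taken componentwise. Randomised algorithm: $Q^{\mathrm{ran\text{-}pr\text{-}sh}}_{d,n,\boldsymbol{z}}(f,\omega) := Q_{d,p(\omega_1),\boldsymbol{z},\boldsymbol{\Delta}(\omega_2)}(f)$ with $\omega = (\omega_1,\omega_2)$, where $p$ is uniformly distributed on $\mathcal{P}_n$, $\boldsymbol{\Delta}$ is uniformly distributed on $[0,1)^d$, and $p$ and $\boldsymbol{\Delta}$ are independent. Worst case root mean square error of a randomised algorithm $A$: $$ e^{\mathrm{rms}}_{d,\alpha,\boldsymbol{\gamma}}(A) := \sup_{f \in \mathcal{H}_{d,\alpha,\boldsymbol{\gamma}},\ \|f\|_{d,\alpha,\boldsymbol{\gamma}}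 \le 1} \sqrt{\mathbb{E}_\omega\big[|A(f,\omega) - I_d(f)|^2\big]}. $$ For $\lambda \in (0,\alpha)$: $\mu_{d,\alpha,\boldsymbol{\gamma}}(\lambda) := \sum_{\boldsymbol{h} \in \mathbb{Z}^d \setminus\{\boldsymbol{0}\}} r_{\alpha,\boldsymbol{\gamma}}^{-1/\lambda}(\boldsymbol{h})$, which is finite.
   Formalization: The claim that C1, C2 can be taken with 0.4<C1<0.5<C2<0.6 fails as stated (n=28 gives ratio 0.357, n=40 gives 0.369) and is not asserted; the bound with C3=0.792 is stated for all positive C1, C2 valid from some threshold n0≥2 on, and for n≥n0. *)

(* Defs.v *)
From HB Require Import structures.
From mathcomp Require Import all_boot all_order all_algebra.
From mathcomp Require Import finmap complex.
From mathcomp Require Import all_classical all_reals all_analysis.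

Set Implicit Arguments.
Unset Strict Implicit.
Unset Printing Implicit Defensive.

Import Order.TTheory GRing.Theory Num.Theory.
Import numFieldNormedType.Exports.

Local Open Scope classical_set_scope.
Local Open Scope ring_scope.

(* n/2 < p <= n is written without division. *)
Definition primes_upper_half (n : nat) : seq nat :=
  [seq p <- index_iota 0 n.+1 | prime p && (n < p.*2)%N].

Definition prime_count_bounds (R : realType) (C1 C2 : R) (n : nat) : Prop :=
  C1 * (n%:R / ln n%:R) <= (size (primes_upper_half n))%:R
    <= C2 * (n%:R / ln n%:R).

(* Points of R^d are tuples, which carry the product sigma-algebra;
   frequencies and generating vectors are integer row vectors. *)
Definition tuple_cons (R : realType) (d : nat)
    (x : measurableTypeR R * d.-tuple R) : d.+1.-tuple R :=
  [tuple of (x.1 : R) :: x.2].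

Lemma measurable_tuple_cons (R : realType) (d : nat) :
  measurable_fun setT (@tuple_cons R d).
Proof.
apply: (@measurable_cons _ _ _ R (fun x => x.1) d (fun x => x.2)).
  exact: (@measurable_fst _ _ (measurableTypeR R)).
exact: measurable_snd.
Qed.

HB.instance Definition _ (R : realType) (d : nat) :=
  isMeasurableFun.Build _ _ _ _ (@tuple_cons R d)
    (@measurable_tuple_cons R d).

(* The d-fold product of the uniform probability on [0,1], i.e. Lebesgue measure
   of the unit cube, seen as a probability on R^d: integrals against it are
   integrals over [0,1]^d, and a point drawn from it is uniform on [0,1)^d
   (the faces of the cube are null). *)
Fixpoint cube (R : realType) (d : nat) : probability (d.-tuple R) R :=
  match d with
  | 0 => dirac ([tuple] : 0.-tuple R)
  | d'.+1 => distribution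
      (uniform_prob (@ltr01 R) \x cube R d')%E
      (@tuple_cons R d')
  end.

Definition cintegral (R : realType) (disp : measure_display)
    (T : measurableType disp) (mu : {measure set T -> \bar R})
    (g : T -> R[i]) : R[i] :=
  ((\int[mu]_x complex.Re (g x)) +i* (\int[mu]_x complex.Im (g x)))%C.

Definition sqnorm (R : realType) (z : R[i]) : R :=
  complex.Re z ^+ 2 + complex.Im z ^+ 2.

Definition cexp (R : realType) (t : R) : R[i] := (cos t +i* sin t)%C.

Definition frac (R : realType) (x : R) : R := x - (Num.floor x)%:~R.

(* Subsets of {1,2,...} are encoded as sets of natural numbers starting at 0:
   the coordinate j + 1 is represented by j. *)
Definition supp (d : nat) (h : 'rV[int]_d) : set nat :=
  [set val j | j in [set j : 'I_d | h 0 j != 0]].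

Definition rweight (R : realType) (gamma : set nat -> R) (alpha : R) (d : nat)
    (h : 'rV[int]_d) : R :=
  (gamma (supp h))^-1 * \prod_(j < d | h 0 j != 0) (`|h 0 j|%:~R `^ alpha).

Definition fourier_coef (R : realType) (d : nat) (f : d.-tuple R -> R[i])
    (h : 'rV[int]_d) : R[i] :=
  cintegral (cube R d)
    (fun x => f x * cexp (- (2 * pi * \sum_(j < d) (h 0 j)%:~R * tnth x j))).

(* Elements of L_2([0,1]^d) are given by Borel representatives, whose values
   outside the cube are irrelevant. *)
Definition in_L2 (R : realType) (d : nat) (f : d.-tuple R -> R[i]) : Prop :=
  [/\ measurable_fun setT (fun x => complex.Re (f x)),
      measurable_fun setT (fun x => complex.Im (f x)) &
      (\int[cube R d]_x (sqnorm (f x))%:E < +oo)%E].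

Definition korobov_norm (R : realType) (gamma : set nat -> R) (alpha : R)
    (d : nat) (f : d.-tuple R -> R[i]) : \bar R :=
  sqrte (\esum_(h in [set: 'rV[int]_d])
    (sqnorm (fourier_coef f h) * rweight gamma alpha h ^+ 2)%:E)%E.

Definition korobov (R : realType) (gamma : set nat -> R) (alpha : R)
    (d : nat) : set (d.-tuple R -> R[i]) :=
  [set f | in_L2 f /\ (korobov_norm gamma alpha f < +oo)%E].

Definition integral_cube (R : realType) (d : nat) (f : d.-tuple R -> R[i]) :
  R[i] := cintegral (cube R d) f.

Definition lattice_rule (R : realType) (d m : nat) (z : 'rV[int]_d)
    (Delta : d.-tuple R) (f : d.-tuple R -> R[i]) : R[i] :=
  (m%:R)^-1 * \sum_(k < m)
    f [tuple frac ((z 0 j)%:~R * k%:R / m%:R + tnth Delta j) | j < d].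

(* A randomised algorithm maps an integrand and an outcome of the probability
   space (Omega, P) to a number. *)
Definition rms_error (R : realType) (gamma : set nat -> R) (alpha : R) (d : nat)
    (disp : measure_display) (Omega : measurableType disp)
    (P : probability Omega R)
    (A : (d.-tuple R -> R[i]) -> Omega -> R[i]) : \bar R :=
  ereal_sup [set sqrte ('E_P[(fun w => sqnorm (A f w - integral_cube f))%R])%E |
    f in [set f | korobov gamma alpha f /\ (korobov_norm gamma alpha f <= 1)%E]].

Lemma measurable_primes_upper_half (n : nat) :
  measurable [set` primes_upper_half n].
Proof. by []. Qed.

(* Counting measure on the primes, normalised; the measure [dirac 0] is the
   default value of [mnormalize], used only if there were no such prime. *)
Definition uniform_primes (R : realType) (n : nat) : probability nat R :=
  mnormalize (mrestr (@counting nat R) (measurable_primes_upper_half n))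
    (dirac 0%N).

(* The product measure makes the number of points and the shift independent. *)
Definition ran_pr_sh_prob (R : realType) (d n : nat) :
    probability (nat * d.-tuple R)%type R :=
  (uniform_primes R n \x cube R d)%E.

Definition ran_pr_sh (R : realType) (d : nat) (z : 'rV[int]_d)
    (f : d.-tuple R -> R[i]) (w : nat * d.-tuple R) : R[i] :=
  lattice_rule w.1 z w.2 f.

(* Extended-real valued; finite whenever 0 < lambda < alpha. *)
Definition mu_sum (R : realType) (gamma : set nat -> R) (alpha : R) (d : nat)
    (lambda : R) : \bar R :=
  (\esum_(h in [set h : 'rV[int]_d | h != 0%R])
    (rweight gamma alpha h `^ (- lambda^-1))%:E)%E.

(* Riemann zeta for real s > 1, where the series converges. *)
Definition zeta (R : realType) (s : R) : R :=
  limn (fun n : nat => \sum_(1 <= k < n) k%:R `^ (- s)).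

Definition weight_sum (R : realType) (gamma : set nat -> R) (alpha lambda : R) :
    \bar R :=
  (\esum_(u in [set u : set nat | finite_set u /\ u !=set0])
    (gamma u `^ lambda^-1
      * (2 * zeta (alpha / lambda)) ^+ #|` fset_set u|%fset)%:E)%E.

(* Main.v *)
(* For a fixed prime p, Parseval shows that the variance of the randomly shifted
   lattice rule is the sum of |f^(h)|^2 over the nonzero h with p | h.z; averaging
   over p, the squared error is at most the supremum over h <> 0 of
   k(h) / (|P_n| r(h)^2), where k(h) is the number of p in P_n dividing h.z.  Only
   the inequality of Bessel type is needed, together with the completeness of the
   trigonometric system.

   Put a(h) = mu(lambda) r(h)^(1/lambda).  At least two elements per unit of rank
   (h and -h) contribute to mu(lambda), so a(h) is at least twice the rank of h, up
   to sign, in the ordering by r, and this ordering does not depend on lambda.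
   Choosing z modulo each p separately, by averaging, one obtains a single z with
   a(h) >= n/4 whenever k(h) > 0 and a(h) >= k(h)! (4/3)^k(h) for every h <> 0.
   Those h that are multiples of some p in P_n reduce to h / p, since
   r(p h)^(1/lambda) >= p r(h)^(1/lambda).  The bound
   k^r <= 4 (C_3 r / ln(r+1))^r k! (4/3)^k then gives the estimate for all lambda
   and r at once. *)
Require Import Defs.
From HB Require Import structures.
From mathcomp Require Import all_boot all_order all_algebra.
From mathcomp Require Import complex ring lra zify.
From mathcomp Require Import all_classical all_reals all_analysis.
From mathcomp Require Import measurable_realfun.

Set Implicit Arguments.
Unset Strict Implicit.
Unset Printing Implicit Defensive.

Import Order.TTheory GRing.Theory Num.Theory.
Import numFieldNormedType.Exports.
Import Defs.

Local Open Scope classical_set_scope.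
Local Open Scope ring_scope.

(** * Shift invariance of the uniform measure on the cube *)

Section frac.
Variable R : realType.
Implicit Types x y : R.

(** The vector is fixed before lambda and r, so its construction may use the order of the
    frequencies but no value of mu; lambda enters afterwards, when a rank is converted into a bound
    by mu. A frequency divisible by p has p | h.z for every z, so no choice of residues helps
    against it: the averaging covers only the h that are nonzero modulo every p in P_n, and the
    others inherit their bounds from h / p, where k grows by at most one on the way back.

    The condition n >= e^(6 C_2) is used as 6 |P_n| <= n. With primes above n/2 and a quarter of the
    residues given up, at least k of the primes divide h.z with probability at most (4/9)^k / k!, so
    a number of frequencies of order k! can be protected for each k. The base 4/3 keeps the total
    failure probability below 1, and its inverse 3/4 produces e^(3/4 - 1) = e^(-1/4) < 0.792 = C_3.

    At the end an exponent 1/r is raised to 2 lambda, which is legitimate because 4 a(h) / n >= 1;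
    this is the purpose of a(h) >= n/4 beside the factorial bound. *)

Lemma frac_bounds x : 0 <= frac x < 1.
Proof.
have /andP[h1 h2] := floor_itv x; rewrite /frac; apply/andP; split; first lra.
by rewrite intrD in h2; lra.
Qed.

Lemma fracDz x (m : int) : frac (x + m%:~R) = frac x.
Proof.
by rewrite /frac floorDrz ?intr_int// intrKfloor intrD opprD addrACA subrr addr0.
Qed.

Lemma frac_id x : 0 <= x < 1 -> frac x = x.
Proof. by move=> x01; rewrite /frac (@floor_def _ x 0)// subr0. Qed.

Lemma fracD_frac x y : frac (frac x + y) = frac (x + y).
Proof. by rewrite -[RHS](fracDz _ (- Num.floor x)) /frac intrN; congr (frac _); ring. Qed.

Lemma measurable_frac : measurable_fun [set: measurableTypeR R] (@frac R).
Proof.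
apply: measurable_funB => //; apply: nondecreasing_measurable => // x y xy.
by rewrite ler_int le_floor.
Qed.

End frac.

Section uniform_shift.
Variable R : realType.
Notation U := (uniform_prob (@ltr01 R)).
Notation mu := (@lebesgue_measure R).

(** Lebesgue measure is determined by its values on half-open intervals, so it is enough to
    translate those. *)
Lemma lebesgue_measure_shift (a : R) (A : set (measurableTypeR R)) : measurable A ->
  mu ((fun x => a + x) @^-1` A) = mu A.
Proof.
have ma : measurable_fun [set: measurableTypeR R] (fun x : measurableTypeR R => a +
  x : measurableTypeR R).
  by apply: measurable_funD; [exact: measurable_cst|exact: measurable_id].
pose ta : {mfun measurableTypeR R >-> measurableTypeR R} :=
  HB.pack (fun x : measurableTypeR R => a + x : measurableTypeR R)
  (isMeasurableFun.Build _ _ _ _ _ ma).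
move=> mA; apply/esym.
rewrite -[RHS]/(pushforward mu ta A).
apply: (@lebesgue_measure_unique R (pushforward mu ta)) => //= X /ocitvP[->|[[b c] /= bc ->]].
  by rewrite !measure0.
rewrite /pushforward /=.
rewrite (_ : _ @^-1` _ = `](b - a)%R, (c - a)%R]%classic); last first.
  apply/seteqP; split => x /=; rewrite !in_itv/= => /andP[? ?]; apply/andP; split; lra.
rewrite !lebesgue_measure_itv/= !lte_fin bc ifT ?ltrD2r//.
by rewrite -!EFinB; congr (_%:E); ring.
Qed.

Lemma uniform_probE (A : set (measurableTypeR R)) : measurable A -> U A = mu (A `&` `[0, 1[).
Proof.
move=> mA; rewrite /uniform_prob integral_uniform_pdf.
rewrite (eq_integral (fun=> 1%:E)); last first.
  by move=> x /[!inE] -[_]; rewrite /= in_itv/= /uniform_pdf subr0 invr1 => ->.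
rewrite integral_cst ?mul1e; last exact: measurableI.
(* The density lives on the closed interval; the end point 1 is null, and the half-open interval is
   the one that a rotation permutes. *)
have -> : A `&` `[0, 1] = (A `&` `[0, 1[) `|` (A `&` [set 1]).
  by rewrite -setIUr setUitv1// bnd_simp ler01.
apply/eqP; rewrite eq_le; apply/andP; split; last first.
  by apply: le_measure; rewrite ?inE; [exact: measurableI|apply: measurableU; exact: measurableI|
   exact: subsetUl].
apply: (le_trans (measureU2 _ _ _)); [exact: measurableI|exact: measurableI|].
rewrite [X in (_ + X <= _)%E](_ : _ = 0) ?adde0//.
apply/eqP; rewrite eq_le measure_ge0 andbT -(lebesgue_measure_set1 1).
by apply: le_measure; rewrite ?inE//; exact: measurableI.
Qed.

(** A rotation of the circle: with b = frac a, a point x moves by b if x < 1 - b and by b - 1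
    otherwise, so the two pieces of [0,1[ are translated onto [b,1[ and [0,b[. *)
Lemma uniform_prob_shift (a : R) (A : set (measurableTypeR R)) : measurable A ->
  U ((fun x => frac (a + x)) @^-1` A) = U A.
Proof.
move=> mA.
have mf : measurable_fun [set: measurableTypeR R] (fun x : measurableTypeR R =>
  frac (a + x) : measurableTypeR R).
  by apply: measurableT_comp; [exact: measurable_frac|by apply: measurable_funD;
    [exact: measurable_cst|exact: measurable_id]].
have mB : measurable ((fun x => frac (a + x)) @^-1` A).
  by rewrite -[X in measurable X]setTI; exact: mf.
rewrite !uniform_probE//.
have /andP[a0 a1] := frac_bounds a; set b := frac a in a0 a1.
have fE x : 0 <= x < 1 -> frac (a + x) = if x < 1 - b then b + x else b - 1 + x.
  move=> /andP[x0 x1]; rewrite -fracD_frac -/b; case: ltP => h.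
    by rewrite frac_id//; apply/andP; split; lra.
  rewrite -(fracDz _ (-1)) frac_id; first by ring.
  by apply/andP; split; rewrite intrN; lra.
have -> : (fun x => frac (a + x)) @^-1` A `&` `[0, 1[ =
  ((fun x => b + x) @^-1` (A `&` `[b, 1[)) `|`
  ((fun x => b - 1 + x) @^-1` (A `&` `[0, b[)).
  apply/seteqP; split => x /=; rewrite !in_itv/=.
    move=> [Ax /[dup] x01 /andP[x0 x1]]; move: Ax; rewrite fE//; case: ltP => h Ax; [left|right];
      split => //.
      by apply/andP; split; lra.
    by apply/andP; split; lra.
  case=> -[Ax /andP[h1 h2]]; (have x01 : 0 <= x < 1 by apply/andP; split; lra); split => //;
    rewrite fE//.
    by rewrite ifT//; lra.
  by rewrite ifF//; apply/negbTE; rewrite -leNgt; lra.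
rewrite measureU; first last.
- apply/seteqP; split => x //= -[[_ +] [_ +]]; rewrite !in_itv/=; lra.
- rewrite -[X in measurable X]setTI; apply: measurable_funD => //; exact: measurableI.
- rewrite -[X in measurable X]setTI; apply: measurable_funD => //; exact: measurableI.
transitivity (mu (A `&` `[b, 1%R[) + mu (A `&` `[0%R, b[))%E.
  by congr (_ + _)%E; apply: lebesgue_measure_shift; exact: measurableI.
rewrite -measureU; [|exact: measurableI|exact: measurableI|].
  congr (mu _); apply/seteqP; split => x /=; rewrite !in_itv/=.
    by move=> [[Ax /andP[? ?]]|[Ax /andP[? ?]]]; split => //; apply/andP; split; lra.
  by move=> [Ax /andP[? ?]]; case: (ltP x b) => h; [right|left]; split => //; apply/andP; split;
    lra.
apply/seteqP; split => x //= -[[_ +] [_ +]]; rewrite !in_itv/=; lra.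
Qed.

End uniform_shift.

(** Translation on the torus. With a = 0 it reduces a point of R^d modulo 1; with a = z k / p it
    turns the random shift into the k-th node of the lattice rule. *)
Definition shift (R : realType) (d : nat) (a : 'I_d -> R) (x : d.-tuple R) : d.-tuple R :=
  [tuple frac (a j + tnth x j) | j < d].

Section cube_shift.
Variable R : realType.

Lemma measurable_shift d (a : 'I_d -> R) : measurable_fun setT (shift a).
Proof.
apply/measurable_fun_tnthP => i /=.
rewrite (_ : _ \o _ = (fun x => frac (a i + x)) \o (fun x : d.-tuple R => tnth x i)); last first.
  by apply/funext => x /=; rewrite tnth_mktuple.
apply: measurableT_comp; last exact: measurable_tnth.
by apply: measurableT_comp; [exact: measurable_frac|by apply: measurable_funD;
  [exact: measurable_cst|exact: measurable_id]].
Qed.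

Lemma shift_cons d (a : 'I_d.+1 -> R) (x : measurableTypeR R) (y : d.-tuple R) :
  shift a (tuple_cons (x, y)) =
  tuple_cons (frac (a ord0 + x) : measurableTypeR R, shift (fun j => a (lift ord0 j)) y).
Proof.
apply: eq_from_tnth => i; rewrite tnth_mktuple /tuple_cons.
case: (unliftP ord0 i) => [j|] ->.
  by rewrite !tnthS tnth_mktuple.
by rewrite !tnth0.
Qed.

(** Induction on d: the sections of the set absorb the shift of the last d coordinates, and the
    first coordinate is a rotation of the circle. *)
Lemma cube_shift d (a : 'I_d -> R) (A : set (d.-tuple R)) : measurable A ->
  cube R d (shift a @^-1` A) = cube R d A.
Proof.
elim: d a A => [|d IH] a A mA.
  rewrite /= (_ : shift a @^-1` A = A)//; apply/seteqP; split => x /=;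
  by rewrite [x]tuple0 [shift _ _]tuple0.
rewrite /= /distribution /pushforward.
set B := tuple_cons (d:=d) @^-1` A.
have mB : measurable B.
  by rewrite -[B]setTI; exact: measurable_tuple_cons.
rewrite (_ : _ @^-1` (shift a @^-1` A) =
  [set p | B (frac (a ord0 + p.1) : measurableTypeR R, shift (fun j => a (lift ord0 j)) p.2)]);
    last first.
  by apply/seteqP; split => -[x y]; rewrite /B /= shift_cons.
rewrite /= /product_measure1/=.
have mphi := measurable_fun_xsection (cube R d) mB.
transitivity (\int[uniform_prob (@ltr01 R)]_x
   ((fun x => cube R d (xsection B x)) \o (fun x : measurableTypeR R =>
     frac (a ord0 + x) : measurableTypeR R)) x)%E.
  apply: eq_integral => x _ /=.
  rewrite -(IH (fun j => a (lift ord0 j)) (xsection B _)); last exact: measurable_xsection.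
  by congr (cube R d _); apply/seteqP; split => y; rewrite /xsection/= !inE/= ?inE.
have mf : measurable_fun [set: measurableTypeR R] (fun x : measurableTypeR R =>
  frac (a ord0 + x) : measurableTypeR R).
  by apply: measurableT_comp; [exact: measurable_frac|by apply: measurable_funD;
    [exact: measurable_cst|exact: measurable_id]].
rewrite -(@ge0_integral_pushforward _ _ _ _ R _ mf _ setT)//.
by apply: eq_measure_integral => C mC _; exact: uniform_prob_shift.
Qed.

End cube_shift.

(** * Complex-valued square integrable functions *)

Section complex_parts.
Variable R : realType.
Implicit Types z w : R[i].

Lemma ReD z w : complex.Re (z + w) = complex.Re z + complex.Re w.
Proof. by case: z; case: w. Qed.
Lemma ImD z w : complex.Im (z + w) = complex.Im z + complex.Im w.
Proof. by case: z; case: w. Qed.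
Lemma ReN z : complex.Re (- z) = - complex.Re z.
Proof. by case: z. Qed.
Lemma ImN z : complex.Im (- z) = - complex.Im z.
Proof. by case: z. Qed.
Lemma ReM z w : complex.Re (z * w) = complex.Re z * complex.Re w - complex.Im z * complex.Im w.
Proof. by case: z; case: w. Qed.
Lemma ImM z w : complex.Im (z * w) = complex.Re z * complex.Im w + complex.Im z * complex.Re w.
Proof. by case: z; case: w. Qed.
Lemma ReJ z : complex.Re z^*%C = complex.Re z.
Proof. by case: z. Qed.
Lemma ImJ z : complex.Im z^*%C = - complex.Im z.
Proof. by case: z. Qed.
Lemma Re_real (a : R) : complex.Re a%:C%C = a. Proof. by []. Qed.
Lemma Im_real (a : R) : complex.Im a%:C%C = 0. Proof. by []. Qed.

Definition partsE := (ReD, ImD, ReN, ImN, ReM, ImM, ReJ, ImJ, Re_real, Im_real).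

Lemma Re_sum I (s : seq I) (F : I -> R[i]) :
  complex.Re (\sum_(i <- s) F i) = \sum_(i <- s) complex.Re (F i).
Proof. by apply: (big_morph (@complex.Re R)) => // z w; rewrite ReD. Qed.
Lemma eq_parts z w : complex.Re z = complex.Re w -> complex.Im z = complex.Im w -> z = w.
Proof. by case: z => a b; case: w => c e /= -> ->. Qed.

Lemma sqnorm_ge0 z : 0 <= sqnorm z.
Proof. by rewrite /sqnorm addr_ge0 ?sqr_ge0. Qed.
Lemma sqnormM z w : sqnorm (z * w) = sqnorm z * sqnorm w.
Proof. by rewrite /sqnorm !partsE; ring. Qed.
Lemma sqnormD_le z w : sqnorm (z + w) <= 2 * sqnorm z + 2 * sqnorm w.
Proof.
rewrite /sqnorm !partsE; move: (complex.Re z) (complex.Re w) (complex.Im z) (complex.Im w) =>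
  a b c e.
by have := sqr_ge0 (a - b); have := sqr_ge0 (c - e); rewrite !expr2; lra.
Qed.
Lemma sqnormN z : sqnorm (- z) = sqnorm z.
Proof. by rewrite /sqnorm !partsE; ring. Qed.
Lemma sqnorm_real (a : R) : sqnorm a%:C%C = a ^+ 2.
Proof. by rewrite /sqnorm !partsE expr0n addr0. Qed.
Lemma mulcJ z : z * z^*%C = (sqnorm z)%:C%C.
Proof. by apply: eq_parts; rewrite !partsE /sqnorm; ring. Qed.
Lemma sqnorm0 : sqnorm (0 : R[i]) = 0.
Proof. by rewrite /sqnorm /= expr0n addr0. Qed.

Lemma cexpD (s t : R) : cexp (s + t) = cexp s * cexp t.
Proof. by apply: eq_parts; rewrite !partsE /= ?cosD ?sinD; ring. Qed.
Lemma cexpN (t : R) : cexp (- t) = (cexp t)^*%C.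
Proof. by apply: eq_parts; rewrite !partsE /= ?cosN ?sinN. Qed.
Lemma sqnorm_cexp (t : R) : sqnorm (cexp t) = 1.
Proof. by rewrite /sqnorm /= cos2Dsin2. Qed.
Lemma cexp0 : cexp (0 : R) = 1.
Proof. by apply: eq_parts; rewrite /= ?cos0 ?sin0. Qed.
Lemma cexpJM (t : R) : cexp t * (cexp t)^*%C = 1.
Proof. by rewrite mulcJ sqnorm_cexp. Qed.
Lemma cexp_natmul (t : R) (n : nat) : cexp (t * n%:R) = cexp t ^+ n.
Proof.
elim: n => [|n IH]; first by rewrite mulr0 cexp0 expr0.
by rewrite -natr1 mulrDr mulr1 cexpD IH exprSr.
Qed.
Lemma cexp_2pi_nat (n : nat) : cexp (2 * pi * n%:R : R) = 1.
Proof.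
rewrite cexp_natmul (_ : cexp (2 * pi) = 1) ?expr1n//.
by apply: eq_parts; rewrite /= mulr_natl ?cos2pi ?sin2pi.
Qed.
Lemma cexp_2pi_int (m : int) : cexp (2 * pi * m%:~R : R) = 1.
Proof.
case: (intP m) => [|n|n]; first by rewrite mulr0 cexp0.
  exact: (cexp_2pi_nat n.+1).
by rewrite intrN mulrN cexpN (cexp_2pi_nat n.+1) conjc1.
Qed.
End complex_parts.

Section square_integrable.
Context (R : realType) (disp : measure_display) (T : measurableType disp)
  (P : probability T R).
Implicit Types f g : T -> R[i].

Definition cmeasurable f :=
  measurable_fun setT (fun x => complex.Re (f x)) /\
  measurable_fun setT (fun x => complex.Im (f x)).

Definition sqdist f g : \bar R := (\int[P]_x (sqnorm (f x - g x))%:E)%E.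

Definition square_integrable f :=
  cmeasurable f /\ (\int[P]_x (sqnorm (f x))%:E < +oo)%E.

Definition cintegrable f :=
  P.-integrable setT (fun x => (complex.Re (f x))%:E) /\
  P.-integrable setT (fun x => (complex.Im (f x))%:E).

Lemma cmeasurableD f g : cmeasurable f -> cmeasurable g -> cmeasurable (fun x => f x + g x).
Proof.
move=> [f1 f2] [g1 g2]; split; under eq_fun do rewrite !partsE; exact: measurable_funD.
Qed.

Lemma cmeasurableN f : cmeasurable f -> cmeasurable (fun x => - f x).
Proof. by move=> [f1 f2]; split; under eq_fun do rewrite !partsE; exact: measurable_funN. Qed.

Lemma cmeasurableB f g : cmeasurable f -> cmeasurable g -> cmeasurable (fun x => f x - g x).
Proof. by move=> mf mg; apply: cmeasurableD => //; exact: cmeasurableN. Qed.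

Lemma cmeasurableM f g : cmeasurable f -> cmeasurable g -> cmeasurable (fun x => f x * g x).
Proof.
move=> [f1 f2] [g1 g2]; split; under eq_fun do rewrite !partsE.
  by apply: measurable_funB; exact: measurable_funM.
by apply: measurable_funD; exact: measurable_funM.
Qed.

Lemma cmeasurable_cst (c : R[i]) : cmeasurable (fun=> c).
Proof. by split; exact: measurable_cst. Qed.

Lemma cmeasurable_real (phi : T -> R) : measurable_fun setT phi ->
  cmeasurable (fun x => (phi x)%:C%C).
Proof. by split => //; exact: measurable_cst. Qed.

Lemma cmeasurableJ f : cmeasurable f -> cmeasurable (fun x => (f x)^*%C).
Proof.
move=> [f1 f2]; split; under eq_fun do rewrite !partsE; first exact: f1.
exact: measurable_funN.
Qed.

Lemma measurable_sqnorm f : cmeasurable f -> measurable_fun setT (fun x => (sqnorm (f x))%:E).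
Proof.
move=> [f1 f2]; apply/measurable_EFinP; rewrite /sqnorm.
by apply: measurable_funD; exact: measurable_funX.
Qed.

Lemma square_integrable_le f (g : T -> \bar R) : cmeasurable f ->
  (forall x, (sqnorm (f x))%:E <= g x)%E ->
  measurable_fun setT g -> (\int[P]_x g x < +oo)%E -> square_integrable f.
Proof.
move=> mf fg mg gi; split=> //; apply: le_lt_trans gi; apply: ge0_le_integral => //.
- by move=> x _; rewrite lee_fin sqnorm_ge0.
- exact: measurable_sqnorm.
Qed.

(** Distances stay squared throughout; the price is the factor 2, which is why tolerances are later
    divided by 4. *)
Lemma sqdist_tri f g k : cmeasurable f -> cmeasurable g -> cmeasurable k ->
  (sqdist f k <= 2%:E * sqdist f g + 2%:E * sqdist g k)%E.
Proof.
move=> mf mg mk; rewrite /sqdist -!ge0_integralZl//; last first.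
- by move=> x _; rewrite lee_fin sqnorm_ge0.
- exact/measurable_sqnorm/cmeasurableB.
- by move=> x _; rewrite lee_fin sqnorm_ge0.
- exact/measurable_sqnorm/cmeasurableB.
have h2 a b : cmeasurable a -> cmeasurable b ->
    measurable_fun setT (fun x => (2%:E * (sqnorm (a x - b x))%:E)%E).
  move=> ma mb; apply: emeasurable_funM; first exact: measurable_cst.
  exact/measurable_sqnorm/cmeasurableB.
rewrite -ge0_integralD//; last first.
- exact: h2.
- by move=> x _; rewrite -EFinM lee_fin mulr_ge0// sqnorm_ge0.
- exact: h2.
- by move=> x _; rewrite -EFinM lee_fin mulr_ge0// sqnorm_ge0.
apply: ge0_le_integral => //.
- by move=> x _; rewrite lee_fin sqnorm_ge0.
- exact/measurable_sqnorm/cmeasurableB.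
- by apply: emeasurable_funD; exact: h2.
- move=> x _; rewrite -!EFinM -EFinD lee_fin.
  by rewrite (_ : f x - k x = (f x - g x) + (g x - k x)) ?sqnormD_le//; ring.
Qed.

Lemma square_integrableD f g : square_integrable f -> square_integrable g ->
  square_integrable (fun x => f x + g x).
Proof.
move=> [mf fi] [mg gi]; apply: (square_integrable_le (g :=
  fun x => (2%:E * (sqnorm (f x))%:E + 2%:E * (sqnorm (g x))%:E)%E)).
- exact: cmeasurableD.
- by move=> x; rewrite -!EFinM -EFinD lee_fin sqnormD_le.
- by apply: emeasurable_funD; apply: emeasurable_funM; try exact: measurable_sqnorm;
  exact: measurable_cst.
- rewrite ge0_integralD//; first last.
  + by apply: emeasurable_funM; try exact: measurable_sqnorm; exact: measurable_cst.
  + by move=> x _; rewrite -EFinM lee_fin mulr_ge0// sqnorm_ge0.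
  + by apply: emeasurable_funM; try exact: measurable_sqnorm; exact: measurable_cst.
  + by move=> x _; rewrite -EFinM lee_fin mulr_ge0// sqnorm_ge0.
  rewrite !ge0_integralZl//; first last.
  + by move=> x _; rewrite lee_fin sqnorm_ge0.
  + exact: measurable_sqnorm.
  + by move=> x _; rewrite lee_fin sqnorm_ge0.
  + exact: measurable_sqnorm.
  by apply: lte_add_pinfty; rewrite lte_mul_pinfty.
Qed.

Lemma square_integrableM f k (B : R) : square_integrable f -> cmeasurable k ->
  (forall x, sqnorm (k x) <= B) -> square_integrable (fun x => k x * f x).
Proof.
move=> [mf fi] mk kB.
have [B0|B0] := ltP B 0.
  by have := le_lt_trans (le_trans (sqnorm_ge0 _) (kB point)) B0; rewrite ltxx.
apply: (square_integrable_le (g := fun x => (B%:E * (sqnorm (f x))%:E)%E)).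
- exact: cmeasurableM.
- by move=> x; rewrite -EFinM lee_fin sqnormM ler_wpM2r// sqnorm_ge0.
- by apply: emeasurable_funM; try exact: measurable_sqnorm; exact: measurable_cst.
- rewrite ge0_integralZl//; first by rewrite lte_mul_pinfty.
    exact: measurable_sqnorm.
  by move=> x _; rewrite lee_fin sqnorm_ge0.
Qed.

Lemma square_integrable_cst (c : R[i]) : square_integrable (fun=> c).
Proof.
split; first exact: cmeasurable_cst.
have := integrable_lty measurableT (finite_measure_integrable_cst P (sqnorm c) measurableT); exact.
Qed.

Lemma square_integrableN f : square_integrable f -> square_integrable (fun x => - f x).
Proof.
by move=> [mf fi]; split; [exact: cmeasurableN|under eq_integral do rewrite sqnormN].
Qed.

Lemma square_integrableZ (c : R[i]) f : square_integrable f -> square_integrable (fun x => c * f x).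
Proof. by move=> fi; apply: (@square_integrableM _ _ (sqnorm c)) => //; exact: cmeasurable_cst. Qed.

Lemma square_integrableB f g : square_integrable f -> square_integrable g ->
  square_integrable (fun x => f x - g x).
Proof. by move=> fi gi; apply: square_integrableD => //; exact: square_integrableN. Qed.

Lemma square_integrable_sum I (s : seq I) (F : I -> T -> R[i]) :
  (forall i, square_integrable (F i)) -> square_integrable (fun x => \sum_(i <- s) F i x).
Proof.
move=> iF; elim: s => [|i s IH].
  by under eq_fun do rewrite big_nil; exact: square_integrable_cst.
by under eq_fun do rewrite big_cons; exact: square_integrableD.
Qed.

Lemma square_integrable_bounded f (B : R) : cmeasurable f -> (forall x, sqnorm (f x) <= B) ->
  square_integrable f.
Proof.
move=> mf fB; rewrite (_ : f = fun x => f x * 1); last by apply/funext => x; rewrite mulr1.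
exact: square_integrableM (square_integrable_cst 1) mf fB.
Qed.

Lemma integrable_sqnorm f : square_integrable f -> P.-integrable setT (fun x => (sqnorm (f x))%:E).
Proof.
move=> [mf fi]; apply/integrableP; split; first exact: measurable_sqnorm.
by under eq_integral do rewrite gee0_abs ?lee_fin ?sqnorm_ge0//.
Qed.

(** Rests on |t| <= 1 + t^2, applied to the real and to the imaginary part. *)
Lemma cintegrable_le f (g : T -> \bar R) : cmeasurable f -> P.-integrable setT g ->
  (forall x, ((1 + sqnorm (f x))%:E <= g x)%E) -> cintegrable f.
Proof.
move=> [m1 m2] gi fg; split; apply: (le_integrable _ _ _ gi) => //.
- exact/measurable_EFinP.
- move=> x _; apply: (le_trans _ (lee_abs _)); apply: le_trans (fg x).
  rewrite lee_fin /sqnorm; have := sqr_ge0 (complex.Im (f x)); have := sqr_ge0 (complex.Re (f x)).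
  have := sqr_ge0 (complex.Re (f x) - 1); have := sqr_ge0 (complex.Re (f x) + 1).
  by rewrite ler_norml !expr2 => *; apply/andP; split; lra.
- exact/measurable_EFinP.
- move=> x _; apply: (le_trans _ (lee_abs _)); apply: le_trans (fg x).
  rewrite lee_fin /sqnorm; have := sqr_ge0 (complex.Re (f x)); have := sqr_ge0 (complex.Im (f x)).
  have := sqr_ge0 (complex.Im (f x) - 1); have := sqr_ge0 (complex.Im (f x) + 1).
  by rewrite ler_norml !expr2 => *; apply/andP; split; lra.
Qed.

Lemma square_cintegrable f : square_integrable f -> cintegrable f.
Proof.
move=> fi; apply: (@cintegrable_le _ (fun x => 1%:E + (sqnorm (f x))%:E)%E).
- by case: fi.
- by apply: integrableD => //; [exact: finite_measure_integrable_cst|exact: integrable_sqnorm].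
- by move=> x; rewrite EFinD.
Qed.

Lemma cintegrableM f g : square_integrable f -> square_integrable g ->
  cintegrable (fun x => f x * g x).
Proof.
move=> fi gi.
have i2 : P.-integrable setT (fun x => (sqnorm (f x))%:E + (sqnorm (g x))%:E)%E.
  by apply: integrableD => //; exact: integrable_sqnorm.
case: (fi) => -[f1 f2] _; case: (gi) => -[g1 g2] _.
have [m1 m2] : cmeasurable (fun x => f x * g x) by exact: cmeasurableM.
split; apply: (le_integrable _ _ _ i2) => //.
- exact/measurable_EFinP.
- move=> x _; apply: (le_trans _ (lee_abs _)); rewrite lee_fin !partsE /sqnorm.
  move: (complex.Re (f x)) (complex.Re (g x)) (complex.Im (f x)) (complex.Im (g x)) => a b c e.
  have := sqr_ge0 (a - b); have := sqr_ge0 (a + b); have := sqr_ge0 (c - e);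
    have := sqr_ge0 (c + e).
  have := sqr_ge0 a; have := sqr_ge0 b; have := sqr_ge0 c; have := sqr_ge0 e.
  by rewrite ler_norml !expr2 => *; apply/andP; split; lra.
- exact/measurable_EFinP.
- move=> x _; apply: (le_trans _ (lee_abs _)); rewrite lee_fin !partsE /sqnorm.
  move: (complex.Re (f x)) (complex.Re (g x)) (complex.Im (f x)) (complex.Im (g x)) => a b c e.
  have := sqr_ge0 (a - e); have := sqr_ge0 (a + e); have := sqr_ge0 (c - b);
    have := sqr_ge0 (c + b).
  have := sqr_ge0 a; have := sqr_ge0 b; have := sqr_ge0 c; have := sqr_ge0 e.
  by rewrite ler_norml !expr2 => *; apply/andP; split; lra.
Qed.

Lemma cintegrableD f g : cintegrable f -> cintegrable g -> cintegrable (fun x => f x + g x).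
Proof.
move=> [f1 f2] [g1 g2]; split; under eq_fun do rewrite !partsE EFinD; exact: integrableD.
Qed.

Lemma cintegrableZ (c : R[i]) f : cintegrable f -> cintegrable (fun x => c * f x).
Proof.
move=> [f1 f2]; split; under eq_fun do rewrite !partsE.
  by under eq_fun do rewrite EFinB !EFinM; apply: integrableB => //; exact: integrableZl.
by under eq_fun do rewrite EFinD !EFinM; apply: integrableD => //; exact: integrableZl.
Qed.

Lemma cintegrable_sum I (s : seq I) (F : I -> T -> R[i]) :
  (forall i, cintegrable (F i)) -> cintegrable (fun x => \sum_(i <- s) F i x).
Proof.
move=> iF; elim: s => [|i s IH].
  by under eq_fun do rewrite big_nil; split; exact: finite_measure_integrable_cst.
by under eq_fun do rewrite big_cons; exact: cintegrableD.
Qed.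

Lemma eq_cintegral g f : f =1 g -> cintegral P f = cintegral P g.
Proof. by move=> /funext ->. Qed.

Lemma Re_cintegral f : complex.Re (cintegral P f) = \int[P]_x complex.Re (f x).
Proof. by []. Qed.

Lemma Im_cintegral f : complex.Im (cintegral P f) = \int[P]_x complex.Im (f x).
Proof. by []. Qed.

Lemma cintegralD f g : cintegrable f -> cintegrable g ->
  cintegral P (fun x => f x + g x) = cintegral P f + cintegral P g.
Proof.
move=> [f1 f2] [g1 g2]; apply: eq_parts; rewrite !partsE ?Re_cintegral ?Im_cintegral -RintegralD//;
by apply: eq_Rintegral => x _; rewrite !partsE.
Qed.

Lemma cintegralZ (c : R[i]) f : cintegrable f ->
  cintegral P (fun x => c * f x) = c * cintegral P f.
Proof.
move=> [f1 f2].
have iZ (r : R) h : P.-integrable setT (fun x => (h x)%:E) ->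
   P.-integrable setT (EFin \o (fun x => r * h x)).
  by move=> ih; rewrite (_ : _ \o _ = (fun x => r%:E * (h x)%:E)%E)//; exact: integrableZl.
apply: eq_parts; rewrite !partsE ?Re_cintegral ?Im_cintegral -!RintegralZl//.
  by rewrite -RintegralB//; try exact: iZ; apply: eq_Rintegral => x _; rewrite !partsE.
by rewrite -RintegralD//; try exact: iZ; apply: eq_Rintegral => x _; rewrite !partsE.
Qed.

Lemma cintegral_sum I (s : seq I) (F : I -> T -> R[i]) :
  (forall i, cintegrable (F i)) ->
  cintegral P (fun x => \sum_(i <- s) F i x) = \sum_(i <- s) cintegral P (F i).
Proof.
move=> iF; elim: s => [|i s IH].
  rewrite big_nil; rewrite (@eq_cintegral (fun=> 0)) => [|x]; last by rewrite big_nil.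
  by apply: eq_parts; rewrite ?Re_cintegral ?Im_cintegral Rintegral_cst// mul0r.
rewrite big_cons -IH -cintegralD//; last exact: cintegrable_sum.
by apply: eq_cintegral => x; rewrite big_cons.
Qed.

Lemma cintegralJ f : cintegrable f -> cintegral P (fun x => (f x)^*%C) = (cintegral P f)^*%C.
Proof.
move=> [f1 f2]; apply: eq_parts; rewrite !partsE ?Re_cintegral ?Im_cintegral.
  by apply: eq_Rintegral => x _; rewrite !partsE.
by rewrite -mulN1r -RintegralZl//; apply: eq_Rintegral => x _; rewrite !partsE mulN1r.
Qed.

(** Dominated convergence in the form that the closure arguments use: one index at which the
    integral is small. *)
Lemma dominated_small (G : nat -> T -> R) (g : T -> \bar R) :
  (forall n, measurable_fun setT (G n)) -> (forall n x, 0 <= G n x) ->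
  (forall x, G n x @[n --> \oo] --> (0 : R)) -> P.-integrable setT g ->
  (forall n x, ((G n x)%:E <= g x)%E) ->
  forall e : R, 0 < e -> exists n, (\int[P]_x (G n x)%:E < e%:E)%E.
Proof.
move=> mG G0 Gc ig Gg e e0.
have mGE n : measurable_fun setT (fun x => (G n x)%:E) by exact/measurable_EFinP.
have H1 : (\forall x \ae P, [set: T] x -> (G n x)%:E @[n --> \oo] --> (cst 0%E x : \bar R)).
  by apply: aeW => x _ /=; apply: cvg_EFin; [exact: nearW|exact: Gc].
have H2 : (\forall x \ae P, forall n, [set: T] x -> (`|(G n x)%:E| <= g x)%E).
  by apply: aeW => x n _ /=; rewrite ger0_norm.
have [_ _] := dominated_convergence measurableT mGE (measurable_cst _) H1 ig H2.
rewrite integral0 => /fine_cvgP[fn /cvgrPdist_lt /(_ e e0)] H.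
near \oo => n; exists n.
have fin : (\int[P]_x (G n x)%:E)%E \is a fin_num by near: n.
have : (`|0 - fine (\int[P]_x (G n x)%:E)| < e)%R by near: n.
rewrite sub0r normrN => hn; rewrite -(fineK fin) lte_fin; apply: le_lt_trans hn; exact: ler_norm.
Unshelve. all: by end_near. Qed.

End square_integrable.

(** * Integrals under a shift of the torus *)

Section integral_shift.
Variables (R : realType) (d : nat) (a : 'I_d -> R).
Notation P := (cube R d).

Lemma ge0_integral_shift (g : d.-tuple R -> \bar R) : measurable_fun setT g ->
  (forall x, 0 <= g x)%E -> (\int[P]_x g (shift a x) = \int[P]_x g x)%E.
Proof.
move=> mg g0; rewrite -[LHS](@ge0_integral_pushforward _ _ _ _ R _ (measurable_shift a) _ setT g)//.
by apply: eq_measure_integral; [exact: measurable_shift|move=> mf A mA _; exact: cube_shift].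
Qed.

Lemma integral_shift (g : d.-tuple R -> \bar R) : measurable_fun setT g ->
  (\int[P]_x g (shift a x) = \int[P]_x g x)%E.
Proof.
move=> mg; rewrite integralE [RHS]integralE; congr (_ - _)%E.
  rewrite -[RHS]ge0_integral_shift//; last exact: measurable_funepos.
  by apply: eq_integral => x _; rewrite !funeposE.
rewrite -[RHS]ge0_integral_shift//; last exact: measurable_funeneg.
by apply: eq_integral => x _; rewrite !funenegE.
Qed.

Lemma cintegral_shift (f : d.-tuple R -> R[i]) : cmeasurable f ->
  cintegral P (fun x => f (shift a x)) = cintegral P f.
Proof.
move=> [m1 m2]; apply: eq_parts; rewrite ?Re_cintegral ?Im_cintegral /Rintegral; congr fine.
  by apply: (@integral_shift (fun x => (complex.Re (f x))%:E)); exact/measurable_EFinP.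
by apply: (@integral_shift (fun x => (complex.Im (f x))%:E)); exact/measurable_EFinP.
Qed.

Lemma cmeasurable_shift (f : d.-tuple R -> R[i]) : cmeasurable f ->
  cmeasurable (fun x => f (shift a x)).
Proof.
move=> [m1 m2]; split.
  exact: (measurableT_comp m1 (measurable_shift a)).
exact: (measurableT_comp m2 (measurable_shift a)).
Qed.

Lemma square_integrable_shift (f : d.-tuple R -> R[i]) : square_integrable P f ->
  square_integrable P (fun x => f (shift a x)).
Proof.
move=> [mf fi]; split; first exact: cmeasurable_shift.
rewrite (@ge0_integral_shift (fun x => (sqnorm (f x))%:E))//; first exact: measurable_sqnorm.
by move=> x; rewrite lee_fin sqnorm_ge0.
Qed.
End integral_shift.

(** * Completeness of the trigonometric system *)

Section characters.
Variables (R : realType) (d : nat).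
Implicit Types (h : 'rV[int]_d) (x : d.-tuple R).

Definition echar h x : R[i] := cexp (2 * pi * \sum_(j < d) (h 0 j)%:~R * tnth x j).

Lemma echarD h k x : echar (h + k) x = echar h x * echar k x.
Proof.
rewrite /echar -cexpD -mulrDr -big_split/=; congr (cexp (_ * _)).
by apply: eq_bigr => j _; rewrite mxE intrD mulrDl.
Qed.

Lemma echar0 x : echar 0 x = 1.
Proof. by rewrite /echar big1 ?mulr0 ?cexp0// => j _; rewrite mxE mul0r. Qed.

Lemma echarN h x : echar (- h) x = (echar h x)^*%C.
Proof.
rewrite /echar -cexpN; congr cexp; rewrite -mulrN -sumrN.
by congr (_ * _); apply: eq_bigr => j _; rewrite mxE intrN mulNr.
Qed.

Lemma sqnorm_echar h x : sqnorm (echar h x) = 1.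
Proof. exact: sqnorm_cexp. Qed.

(** The integer parts removed by [frac] change the phase by 2 pi times an integer, the [m] of the
    proof. *)
Lemma echar_shift h (a : 'I_d -> R) x :
  echar h (shift a x) = cexp (2 * pi * \sum_(j < d) (h 0 j)%:~R * a j) * echar h x.
Proof.
rewrite /echar -cexpD -mulrDr -big_split/=.
pose m := \sum_(j < d) h 0 j * Num.floor (a j + tnth x j).
rewrite -[LHS]mulr1 -(cexp_2pi_int R m) -cexpD -mulrDr; congr (cexp (_ * _)).
rewrite /m (raddf_sum (intr : int -> R)) -big_split/=; apply: eq_bigr => j _.
by rewrite tnth_mktuple /frac intrM; ring.
Qed.

Lemma cmeasurable_echar h : cmeasurable (echar h).
Proof.
have mS : measurable_fun setT (fun x => 2 * pi * \sum_(j < d) (h 0 j)%:~R * tnth x j).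
  apply: measurable_funM; first exact: measurable_cst.
  apply: measurable_sum => j; apply: measurable_funM; first exact: measurable_cst.
  exact: measurable_tnth.
split => /=.
  exact: (measurableT_comp (continuous_measurable_fun (@continuous_cos R)) mS).
exact: (measurableT_comp (continuous_measurable_fun (@continuous_sin R)) mS).
Qed.

Lemma square_integrable_echar h : square_integrable (cube R d) (echar h).
Proof.
apply: (@square_integrable_bounded _ _ _ _ _ 1); first exact: cmeasurable_echar.
by move=> x; rewrite sqnorm_echar.
Qed.

Lemma fourier_coefE f h : fourier_coef f h = cintegral (cube R d) (fun x => f x * (echar h x)^*%C).
Proof. by rewrite /fourier_coef; apply: eq_cintegral => x; rewrite cexpN. Qed.

(* A shift by half a period in a coordinate where h is nonzero flips the sign. *)
Lemma cintegral_echar h : cintegral (cube R d) (echar h) = (h == 0)%:R.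
Proof.
case: eqP => [->|/eqP h0].
  rewrite (@eq_cintegral _ _ _ _ (fun=> 1)); last by move=> x; rewrite echar0.
  by apply: eq_parts; rewrite ?Re_cintegral ?Im_cintegral Rintegral_cst//= probability_setT/= mulr1.
have [j hj] : exists j, h 0 j != 0.
  by apply/existsP; apply: contraNT h0 => /existsPn H; apply/eqP/rowP => j; rewrite mxE; apply/eqP;
    have := H j; rewrite negbK.
pose a (i : 'I_d) : R := if i == j then (2 * (h 0 j)%:~R)^-1 else 0.
have hjR : ((h 0 j)%:~R : R) != 0 by rewrite intr_eq0.
have E : cintegral (cube R d) (echar h) = - cintegral (cube R d) (echar h).
  rewrite -{1}(cintegral_shift a); last exact: cmeasurable_echar.
  rewrite -mulN1r -cintegralZ; last exact: square_cintegrable (square_integrable_echar h).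
  apply: eq_cintegral => x; rewrite echar_shift; congr (_ * _).
  rewrite (bigD1 j)//= big1 ?addr0; last by move=> i /negbTE ij; rewrite /a ij mulr0.
  rewrite /a eqxx (_ : 2 * pi * _ = pi); last by field.
  by apply: eq_parts; rewrite /= ?cospi ?sinpi ?oppr0.
move: E => /eqP; rewrite -subr_eq0 opprK -mulr2n mulrn_eq0/= => /eqP -> //.
Qed.

Lemma echar_orthonormal h k :
  cintegral (cube R d) (fun x => echar h x * (echar k x)^*%C) = (h == k)%:R.
Proof.
rewrite -subr_eq0 -cintegral_echar; apply: eq_cintegral => x.
by rewrite echarD echarN.
Qed.

End characters.

Section trig_closure.
Variables (R : realType) (d : nat).
Notation P := (cube R d).
Notation T := (d.-tuple R).
Implicit Types (f g : T -> R[i]) (h : 'rV[int]_d).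

Definition trigpoly (s : seq (R[i] * 'rV[int]_d)) (x : T) : R[i] :=
  \sum_(p <- s) p.1 * echar p.2 x.

(** The L_2 closure of the trigonometric polynomials. *)
Definition trig_approx f := square_integrable P f /\
  forall e : R, 0 < e -> exists s, (sqdist P f (trigpoly s) < e%:E)%E.

Lemma square_integrable_trigpoly s : square_integrable P (trigpoly s).
Proof.
apply: square_integrable_sum => p; apply: square_integrableZ; exact: square_integrable_echar.
Qed.

Lemma cmeasurable_trigpoly s : cmeasurable (trigpoly s).
Proof. by case: (square_integrable_trigpoly s). Qed.

Lemma sqdistDr f g k : sqdist P (fun x => f x + k x) (fun x => g x + k x) = sqdist P f g.
Proof. by apply: eq_integral => x _; congr (sqnorm _)%:E; ring. Qed.

Lemma sqdistDl f g k : sqdist P (fun x => k x + f x) (fun x => k x + g x) = sqdist P f g.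
Proof. by apply: eq_integral => x _; congr (sqnorm _)%:E; ring. Qed.

Lemma sqdistM_le f g k (B : R) : cmeasurable f -> cmeasurable g -> cmeasurable k -> 0 <= B ->
  (forall x, sqnorm (k x) <= B) ->
  (sqdist P (fun x => k x * f x)%R (fun x => k x * g x)%R <= B%:E * sqdist P f g)%E.
Proof.
move=> mf mg mk B0 kB; rewrite /sqdist -ge0_integralZl//; first last.
- by move=> x _; rewrite lee_fin sqnorm_ge0.
- exact/measurable_sqnorm/cmeasurableB.
apply: ge0_le_integral => //.
- by move=> x _; rewrite lee_fin sqnorm_ge0.
- by apply: measurable_sqnorm; apply: cmeasurableB; exact: cmeasurableM.
- by apply: emeasurable_funM; [exact: measurable_cst|exact/measurable_sqnorm/cmeasurableB].
- by move=> x _; rewrite -mulrBr sqnormM -EFinM lee_fin ler_wpM2r// sqnorm_ge0.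
Qed.

Lemma trig_approx_limit f : square_integrable P f ->
  (forall e : R, 0 < e -> exists g, trig_approx g /\ (sqdist P f g < e%:E)%E) -> trig_approx f.
Proof.
move=> fi H; split=> // e e0.
have e4 : 0 < e / 4 by lra.
have [g [[[mg _] gs] fg]] := H _ e4; have [s gss] := gs _ e4; exists s.
apply: le_lt_trans (sqdist_tri P _ mg (cmeasurable_trigpoly s)) _; first by case: fi.
rewrite (_ : e%:E = 2%:E * (e / 4)%:E + 2%:E * (e / 4)%:E)%E; last by rewrite -!EFinM -EFinD;
  congr EFin; field.
by apply: lteD; rewrite lte_pmul2l.
Qed.

Lemma trig_approxD f g : trig_approx f -> trig_approx g -> trig_approx (fun x => f x + g x).
Proof.
move=> [fi Hf] [gi Hg]; split; first exact: square_integrableD.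
move=> e e0; have e4 : 0 < e / 4 by lra.
have [s fs] := Hf _ e4; have [t gt] := Hg _ e4; exists (s ++ t).
rewrite (_ : trigpoly (s ++ t) = fun x => trigpoly s x + trigpoly t x); last first.
  by apply/funext => x; rewrite /trigpoly big_cat.
case: (fi) (gi) => mf _ [mg _].
apply: le_lt_trans (sqdist_tri P _ (cmeasurableD (cmeasurable_trigpoly s) mg) _) _.
- exact: cmeasurableD.
- by apply: cmeasurableD; exact: cmeasurable_trigpoly.
rewrite sqdistDr sqdistDl.
rewrite (_ : e%:E = 2%:E * (e / 4)%:E + 2%:E * (e / 4)%:E)%E; last by rewrite -!EFinM -EFinD;
  congr EFin; field.
by apply: lteD; rewrite lte_pmul2l.
Qed.

Lemma trig_approxM f k (B : R) : cmeasurable k -> (forall x, sqnorm (k x) <= B) ->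
  (forall s, exists t, forall x, k x * trigpoly s x = trigpoly t x) ->
  trig_approx f -> trig_approx (fun x => k x * f x).
Proof.
move=> mk kB ks [fi Hf]; split; first exact: square_integrableM mk kB.
move=> e e0.
have B0 : 0 <= B by exact: le_trans (sqnorm_ge0 _) (kB point).
have B1 : 0 < B + 1 by lra.
have [s fs] := Hf (e / (B + 1)) (divr_gt0 e0 B1).
have [t /funext st] := ks s; exists t; rewrite -st.
apply: (@le_lt_trans _ _ ((B + 1)%:E * sqdist P f (trigpoly s))%E).
  apply: sqdistM_le => //; [by case: fi|exact: cmeasurable_trigpoly|exact: ltW|].
  by move=> x; rewrite (le_trans (kB x))//; lra.
by rewrite -lte_pdivlMl// -EFinM mulrC.
Qed.

Lemma trig_approxZ (c : R[i]) f : trig_approx f -> trig_approx (fun x => c * f x).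
Proof.
apply: (@trig_approxM _ (fun=> c) (sqnorm c)); [exact: cmeasurable_cst|by []|].
move=> s; exists [seq (c * p.1, p.2) | p <- s] => x.
by rewrite /trigpoly big_map mulr_sumr; apply: eq_bigr => p _; rewrite mulrA.
Qed.

Lemma trig_approx_echarM h f : trig_approx f -> trig_approx (fun x => echar h x * f x).
Proof.
apply: (@trig_approxM _ (echar h) 1); first exact: cmeasurable_echar.
  by move=> x; rewrite sqnorm_echar.
move=> s; exists [seq (p.1, h + p.2) | p <- s] => x.
rewrite /trigpoly big_map mulr_sumr; apply: eq_bigr => p _ /=; rewrite echarD; ring.
Qed.

Lemma trig_approx1 : trig_approx (fun=> 1).
Proof.
split; first exact: square_integrable_cst.
move=> e e0; exists [:: (1, 0)]; rewrite /sqdist.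
under eq_integral do rewrite /trigpoly big_seq1 echar0 mulr1 subrr sqnorm0.
by rewrite integral0 lte_fin.
Qed.

(* The multipliers form an algebra closed under bounded pointwise limits, which is
   how the indicators of all measurable sets (composed with reduction modulo 1) are
   reached from the trigonometric polynomials. *)
Definition multiplier (phi : T -> R) := [/\ measurable_fun setT phi,
  exists B, forall x, `|phi x| <= B &
  forall g, trig_approx g -> trig_approx (fun x => (phi x)%:C%C * g x)].

Lemma multiplier_cst (c : R) : multiplier (fun=> c).
Proof.
split; [exact: measurable_cst|by exists (Num.norm c)|].
by move=> g; exact: trig_approxZ.
Qed.

Lemma multiplierD phi psi : multiplier phi -> multiplier psi -> multiplier (fun x => phi x + psi x).
Proof.
move=> [m1 [B1 b1] h1] [m2 [B2 b2] h2]; split; first exact: measurable_funD.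
  by exists (B1 + B2) => x; rewrite (le_trans (ler_normD _ _))// lerD.
move=> g Cg; under eq_fun do rewrite rmorphD mulrDl.
by apply: trig_approxD; [exact: h1|exact: h2].
Qed.

Lemma multiplierM phi psi : multiplier phi -> multiplier psi -> multiplier (fun x => phi x * psi x).
Proof.
move=> [m1 [B1 b1] h1] [m2 [B2 b2] h2]; split; first exact: measurable_funM.
  by exists (B1 * B2) => x; rewrite normrM ler_pM.
move=> g Cg; under eq_fun do rewrite rmorphM -mulrA.
by apply: h1; exact: h2.
Qed.

Lemma multiplierZ c phi : multiplier phi -> multiplier (fun x => c * phi x).
Proof. by move=> mphi; apply: multiplierM => //; exact: multiplier_cst. Qed.

(** A cosine is half the sum of two characters, and multiplication by a character only translates
    frequencies. *)
Lemma multiplier_cos (j : 'I_d) (b : R) : multiplier (fun x => cos (2 * pi * tnth x j + b)).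
Proof.
have m1 : measurable_fun setT (fun x : T => cos (2 * pi * tnth x j + b)).
  apply: (measurableT_comp (continuous_measurable_fun (@continuous_cos R))).
  apply: measurable_funD; last exact: measurable_cst.
  by apply: measurable_funM; [exact: measurable_cst|exact: measurable_tnth].
split => //; first by exists 1 => x; rewrite ler_norml cos_geN1 cos_le1.
move=> g Cg; pose h : 'rV[int]_d := delta_mx 0 j.
have hE x : echar h x = cexp (2 * pi * tnth x j) :> R[i].
  rewrite /echar (bigD1 j)//= big1 ?addr0; first by rewrite /h mxE !eqxx mul1r.
  by move=> i /negbTE ij; rewrite /h mxE ij andbF mul0r.
rewrite (_ : (fun x => _) = fun x => (cexp b / 2) * (echar h x * g x) + (cexp (- b) / 2) *
  (echar (- h) x * g x)).
  by apply: trig_approxD; apply: trig_approxZ; exact: trig_approx_echarM.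
apply/funext => x; rewrite echarN hE.
rewrite (_ : (cos _)%:C%C = (cexp b * cexp (2 * pi * tnth x j) + cexp (- b) *
  (cexp (2 * pi * tnth x j))^*%C) / 2).
  by field.
rewrite -cexpN -!cexpD -opprD cexpN addrC (addrC b) -ReJ_add.
by [].
Qed.

(** The squared error |phi - phi_n|^2 |g|^2 tends to 0 pointwise and is dominated by 4 B^2 |g|^2, so
    the products phi_n g approximate phi g. *)
Lemma multiplier_limit (phi_ : nat -> T -> R) phi (B : R) : (forall n, multiplier (phi_ n)) ->
  (forall n x, `|phi_ n x| <= B) -> (forall x, phi_ n x @[n --> \oo] --> phi x) -> multiplier phi.
Proof.
move=> H bn cn.
have b x : `|phi x| <= B.
  rewrite -(cvg_lim _ (cvg_norm (cn x)))//; apply: limr_le.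
    by apply/cvg_ex; exists `|phi x|; exact: (cvg_norm (cn x)).
  exact: nearW.
have mphi : measurable_fun setT phi.
  by apply: (measurable_fun_cvg (h := phi_)) => [n|x _]; [case: (H n)|exact: cn].
split => //; first by exists B.
move=> g Cg; have [gi _] := Cg; have [mg _] := gi.
have sq2 (r : R) : `|r| <= B -> r ^+ 2 <= B ^+ 2.
  by move=> rB; rewrite -[r ^+ 2]ger0_norm ?sqr_ge0// normrX lerXn2r ?nnegrE//; exact: le_trans rB.
have mM (u : T -> R) : measurable_fun setT u -> cmeasurable (fun x => (u x)%:C%C * g x).
  by move=> mu; apply: cmeasurableM => //; exact: cmeasurable_real.
apply: trig_approx_limit.
  apply: (square_integrableM (B := B ^+ 2) gi (cmeasurable_real mphi)).
  by move=> x; rewrite sqnorm_real; apply: sq2; exact: b.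
move=> e e0.
pose G n x := sqnorm ((phi x)%:C%C * g x - (phi_ n x)%:C%C * g x).
have GE n x : G n x = (phi x - phi_ n x) ^+ 2 * sqnorm (g x).
  by rewrite /G -mulrBl sqnormM -rmorphB sqnorm_real.
have [n Hn] : exists n, (\int[P]_x (G n x)%:E < e%:E)%E.
  apply: (@dominated_small _ _ _ _ _ (fun x => (4 * B ^+ 2)%:E * (sqnorm (g x))%:E)%E) => //.
  - move=> n; apply/measurable_EFinP/measurable_sqnorm/cmeasurableB; apply: mM => //.
    by case: (H n).
  - by move=> n x; exact: sqnorm_ge0.
  - move=> x; have h : phi x - phi_ n x @[n --> \oo] --> (0 : R).
      by rewrite -[X in _ --> X](subrr (phi x)); apply: cvgB; [exact: cvg_cst|exact: cn].
    rewrite (_ : (fun n => G n x) =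
      (fun n => (phi x - phi_ n x) * (phi x - phi_ n x) * sqnorm (g x))); last first.
      by apply/funext => n; rewrite GE expr2.
    have := cvgM (cvgM h h) (cvg_cst (sqnorm (g x))); rewrite !mul0r; exact.
  - by apply: integrableZl => //; exact: integrable_sqnorm.
  - move=> n x; rewrite -EFinM lee_fin GE ler_wpM2r ?sqnorm_ge0//.
    have := sq2 _ (b x); have := sq2 _ (bn n x); have := sqr_ge0 (phi x + phi_ n x).
    by rewrite !expr2; lra.
exists (fun x => (phi_ n x)%:C%C * g x); split => //.
by case: (H n) => _ _; apply.
Qed.

(* Iterating this odd cubic from any point of [-1, 1] converges to the sign. *)
Definition sgn_step (y : R) := y * (3 - y ^+ 2) / 2.

Lemma sgn_step_cvg (y : R) : `|y| <= 1 ->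
  (forall n, `|iter n sgn_step y| <= 1) /\ iter n sgn_step y @[n --> \oo] --> Num.sg y.
Proof.
have pos (u : R) : 0 < u <= 1 ->
  (forall n, 0 <= iter n sgn_step u <= 1) /\ iter n sgn_step u @[n --> \oo] --> (1 : R).
  move=> /andP[u0 u1].
  (* The gap to 1 contracts: one step multiplies 1 - z by 1 - (z + z^2)/2, and z >= u bounds this
     factor by 1 - u/2. *)
  have H n : u <= iter n sgn_step u <= 1 /\ 1 - iter n sgn_step u <= (1 - u / 2) ^+ n.
    elim: n => [|n /= [/andP[]]]; first by rewrite /= expr0 lexx u1; split => //; lra.
    set z := iter n _ _ => uz z1 IH.
    have z0 : 0 < z by lra.
    have E : 1 - sgn_step z = (1 - z) * (1 - (z + z ^+ 2) / 2) by rewrite /sgn_step; field.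
    have z2 : z ^+ 2 <= 1 by rewrite expr2; nra.
    have z20 : 0 <= z ^+ 2 by exact: sqr_ge0.
    have le1 : z <= sgn_step z by rewrite /sgn_step; nra.
    have h0 : 0 <= (1 - z) * (1 - (z + z ^+ 2) / 2) by apply: mulr_ge0; lra.
    split; first by apply/andP; split; lra.
    rewrite E [leRHS]exprSr; apply: ler_pM; lra.
  split=> [n|].
    by have [/andP[h1 h2] _] := H n; apply/andP; split; lra.
  rewrite (_ : (fun n => _) = fun n => 1 - (1 - iter n sgn_step u)); last by apply/funext => n;
    ring.
  rewrite -[X in _ --> X]subr0; apply: cvgB; first exact: cvg_cst.
  apply: (@squeeze_cvgr _ _ _ _ (fun=> 0) (fun n => (1 - u / 2) ^+ n)).
  - by apply: nearW => n; have [/andP[_ h1] ->] := H n; rewrite andbT; lra.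
  - exact: cvg_cst.
  - by apply: cvg_expr; rewrite ger0_norm; lra.
have odd (u : R) n : iter n sgn_step (- u) = - iter n sgn_step u.
  by elim: n => //= n ->; rewrite /sgn_step sqrrN; field.
rewrite ler_norml => /andP[y1 y2].
case: (ltrgtP y 0) => y0.
- have /pos[h1 h2] : 0 < - y <= 1 by apply/andP; split; lra.
  split => [n|].
    by have := h1 n; rewrite odd => /andP[? ?]; rewrite ler_norml; apply/andP; split; lra.
  rewrite ltr0_sg// (_ : (fun n => _) = fun n => - iter n sgn_step (- y)); last first.
    by apply/funext => n; rewrite odd opprK.
  exact: cvgN.
- have /pos[h1 h2] : 0 < y <= 1 by rewrite y0.
  split => [n|]; last by rewrite gtr0_sg.
  by have /andP[? ?] := h1 n; rewrite ler_norml; apply/andP; split; lra.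
- have E n : iter n sgn_step y = 0.
    by rewrite y0; elim: n => //= n ->; rewrite /sgn_step mul0r mul0r.
  split => [n|]; first by rewrite E normr0 ler01.
  by rewrite y0 sgr0; under eq_fun do rewrite -y0 E; exact: cvg_cst.
Qed.

(** The iterates of [sgn_step] are polynomials in phi, hence multipliers, and stay in [-1, 1]. *)
Lemma multiplier_sg phi : multiplier phi -> (forall x, `|phi x| <= 1) ->
  multiplier (fun x => Num.sg (phi x)).
Proof.
move=> mphi b; apply: (@multiplier_limit (fun n x => iter n sgn_step (phi x)) _ 1).
- elim=> [|n IH] /=; first exact: mphi.
  rewrite /sgn_step; under eq_fun do rewrite mulrC expr2.
  apply: multiplierM; first exact: multiplier_cst.
  apply: multiplierM => //; apply: multiplierD; first exact: multiplier_cst.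
  by under eq_fun do rewrite -mulN1r; apply: multiplierZ; apply: multiplierM.
- by move=> n x; have [] := sgn_step_cvg (b x).
- by move=> x; have [] := sgn_step_cvg (b x).
Qed.

End trig_closure.

(** * From indicators of measurable sets to all square-integrable functions *)

Section measurable_sets_approx.
Variables (R : realType) (d : nat).
Notation P := (cube R d).
Notation T := (d.-tuple R).

(** Indicators are composed with reduction modulo 1 because pointwise limits of trigonometric
    polynomials are 1-periodic. *)
Let fold : T -> T := shift (fun=> 0).

Definition multiplier_set (A : set T) := multiplier (fun x => \1_A (fold x) : R).

Lemma multiplier_setC A : multiplier_set A -> multiplier_set (~` A).
Proof.
move=> HA; rewrite /multiplier_set.
rewrite (_ : (fun x => _) = fun x => 1 + (-1) * \1_A (fold x)); last first.
  by apply/funext => x; rewrite !indicE in_setC; case: (_ \in A);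
    rewrite /= ?mulr1 ?mulr0 ?subrr ?addr0.
by apply: multiplierD; [exact: multiplier_cst|exact: multiplierZ].
Qed.

Lemma multiplier_setI A B : multiplier_set A -> multiplier_set B -> multiplier_set (A `&` B).
Proof.
by move=> HA HB; rewrite /multiplier_set indicI; exact: multiplierM.
Qed.

Lemma multiplier_setU A B : multiplier_set A -> multiplier_set B -> multiplier_set (A `|` B).
Proof.
move=> HA HB; rewrite -[A `|` B]setCK setCU; apply: multiplier_setC.
by apply: multiplier_setI; exact: multiplier_setC.
Qed.

Lemma multiplier_set0 : multiplier_set set0.
Proof. by rewrite /multiplier_set indic0; exact: multiplier_cst. Qed.

Lemma multiplier_bigcup (A : (set T)^nat) : (forall n, multiplier_set (A n)) ->
  multiplier_set (\bigcup_n A n).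
Proof.
move=> HA; pose B n := \big[setU/set0]_(i < n) A i.
apply: (@multiplier_limit _ _ (fun n x => \1_(B n) (fold x)) _ 1).
- elim=> [|n IH]; first by rewrite /B big_ord0; exact: multiplier_set0.
  by rewrite /B big_ord_recr /=; apply: multiplier_setU.
- by move=> n x; rewrite indicE; case: (_ \in _); rewrite ?normr1 ?normr0.
- move=> x; rewrite [X in _ --> X]indicE; case: (boolP (_ \in \bigcup_n A n)) => xA.
    move: xA; rewrite inE => -[k _ Ak].
    apply: cvg_near_cst; near=> n; rewrite indicE mem_set//.
    rewrite /B -bigcup_mkord; exists k => //=; near: n; exact: nbhs_infty_gt.
  apply: cvg_near_cst; near=> n; rewrite indicE memNset// /B -bigcup_mkord => -[k _ Ak].
  by move: xA; rewrite notin_setE; apply; exists k.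
Unshelve. all: by end_near. Qed.

(* sin(pi x) sin(pi (c - x)) has period 1, is a trigonometric polynomial in 2 pi x,
   and on the interval 0 < x < 1 has the sign of c - x. *)
Lemma multiplier_set_open (j : 'I_d) (c : R) : 0 < c < 1 ->
  multiplier_set [set x | 0 < tnth x j < c].
Proof.
move=> /andP[c0 c1].
pose y (x : T) : R := (cos (2 * pi * tnth x j + - (pi * c)) - cos (pi * c)) / 2.
have My : multiplier y.
  have -> : y = (fun x : T => 2^-1 * (cos (2 * pi * tnth x j + - (pi * c)) + -1 * cos (pi * c))).
    by apply/funext => x; rewrite /y; field.
  apply: multiplierZ; apply: multiplierD; first exact: multiplier_cos.
  exact: multiplier_cst.
have yE x : y x = sin (pi * frac (tnth x j)) * sin (pi * (c - frac (tnth x j))).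
  set t := frac _.
  have E : cos (2 * pi * tnth x j + - (pi * c)) = cos (2 * pi * t - pi * c).
    pose k := Num.floor (tnth x j).
    have -> : 2 * pi * tnth x j + - (pi * c) = 2 * pi * t - pi * c + 2 * pi * k%:~R.
      by rewrite /t /frac -/k; ring.
    have := congr1 (@complex.Re R) (cexpD (2 * pi * t - pi * c) (2 * pi * k%:~R)).
    by rewrite cexp_2pi_int mulr1.
  rewrite /y E (_ : 2 * pi * t - pi * c = pi * t - pi * (c - t)); last by ring.
  rewrite [X in _ - cos X](_ : pi * c = pi * t + pi * (c - t)); last by ring.
  by rewrite cosB cosD; field.
have y1 x : `|y x| <= 1.
  rewrite yE normrM -[leRHS]mulr1; apply: ler_pM => //; rewrite ler_norml sin_geN1 sin_le1//.
have ys x : (0 < y x) = (0 < frac (tnth x j) < c).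
  have /andP[] := frac_bounds (tnth x j); rewrite yE; move: (frac _) => t t0 t1.
  have p0 := pi_gt0 R.
  case: (ltrgtP 0 t) t0 => // t0 _; last by rewrite -t0 mulr0 sin0 mul0r ltxx.
  have s1 : 0 < sin (pi * t).
    by apply: sin_gt0_pi; apply/andP; split; [exact: mulr_gt0|rewrite -[ltRHS]mulr1 ltr_pM2l].
  rewrite pmulr_rgt0//= ; case: (ltP t c) => tc.
    apply: sin_gt0_pi; apply/andP; split; first by apply: mulr_gt0; lra.
    by rewrite -[ltRHS]mulr1 ltr_pM2l//; lra.
  apply/negbTE; rewrite -leNgt -oppr_ge0 -sinN; apply: sin_ge0_pi; rewrite -mulrN.
  apply/andP; split; first by apply: mulr_ge0; lra.
  by rewrite -[leRHS]mulr1 ler_pM2l//; lra.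
(* The indicator of y > 0 is (sg y + (sg y)^2) / 2. *)
rewrite /multiplier_set (_ : (fun x => _) = fun x => 2^-1 *
  (Num.sg (y x) + Num.sg (y x) * Num.sg (y x))).
  have Ms := multiplier_sg My y1.
  by apply: multiplierZ; apply: multiplierD => //; exact: multiplierM.
apply/funext => x; rewrite indicE.
have -> : (fold x \in [set x | 0 < tnth x j < c]) = (0 < y x).
  by apply/idP/idP; rewrite inE/= /fold tnth_mktuple add0r ys.
by case: sgrP => h /=; rewrite ?mulr0 ?addr0 ?mulr0 ?mulrNN ?mulr1 ?addNr ?mulr0 //; field.
Qed.

(** The half-lines t < c generate the Borel sets. After folding t lies in [0,1[, so c <= 0 gives the
    empty set, c >= 1 everything, and only 0 < c < 1 has content. *)
Lemma multiplier_set_tnth (j : 'I_d) (B : set R) : measurable (B : set (measurableTypeR R)) ->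
  multiplier_set [set x | B (tnth x j)].
Proof.
pose S := [set B : set R | multiplier_set [set x | B (tnth x j)]].
rewrite RGenInftyO.measurableE => mB; suff : S B by [].
move: mB; apply: smallest_sub.
  split.
  - exact: multiplier_set0.
  - by move=> A SA; rewrite setTD; exact: (multiplier_setC SA).
  - move=> A SA; rewrite /S /= (_ : [set x | _] = \bigcup_n [set x | A n (tnth x j)])//.
    exact: multiplier_bigcup.
have eqfold A A' : (forall x, A (fold x) <-> A' (fold x)) -> multiplier_set A -> multiplier_set A'.
  move=> AA'; rewrite /multiplier_set; congr multiplier; apply/funext => x; rewrite !indicE.
  by congr ((_ : bool)%:R); apply/idP/idP; rewrite !inE => /AA'.
have foldb x : 0 <= tnth (fold x) j < 1 by rewrite tnth_mktuple frac_bounds.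
move=> _ [c ->]; rewrite /S /=.
have [c0|c0] := leP c 0.
  apply: eqfold multiplier_set0 => x; split => //=; rewrite ?in_itv/= => h.
  by have /andP[] := foldb x; lra.
have [c1|c1] := leP 1 c.
  apply: eqfold (multiplier_setC multiplier_set0) => x; split => [_|_ []]; rewrite /= ?in_itv/=.
  by have /andP[] := foldb x; lra.
(* Since t < 1 after folding, t > 0 is the union of the conditions 0 < t < 1 - 1/(n + 2). *)
have S0 : multiplier_set [set x | 0 < tnth x j].
  apply: (eqfold (\bigcup_n [set x | 0 < tnth x j < 1 - n.+2%:R^-1])); last first.
    apply: multiplier_bigcup => n; apply: multiplier_set_open.
    by rewrite subr_gt0 invf_lt1// ltr1n gtrBl invr_gt0 ltr0n.
  move=> x; split => /=; first by move=> [n _ /andP[]].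
  move=> t0; have /andP[_ t1] := foldb x.
  have e0 : 0 < 1 - tnth (fold x) j by rewrite subr_gt0.
  have [n Hn] := ltr_add_invr e0; exists n => //=; rewrite t0/=.
  have le1 : (n.+2%:R^-1 : R) <= n.+1%:R^-1 by rewrite lef_pV2 ?posrE// ler_nat.
  rewrite add0r in Hn; have := le_lt_trans le1 Hn.
  by rewrite ltrBrDr addrC -ltrBrDr.
have c01 : 0 < c < 1 by apply/andP; split.
(* The half-line also contains the point t = 0, supplied by the complement of t > 0. *)
apply: (eqfold ([set x | 0 < tnth x j < c] `|` ~` [set x | 0 < tnth x j])); last first.
  by apply: multiplier_setU; [exact: multiplier_set_open|exact: multiplier_setC].
move=> x; rewrite /= ?in_itv/=; have /andP[t0 t1] := foldb x; split.
  by case=> [/andP[]//|/negP]; rewrite -leNgt => /le_lt_trans; apply.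
by move=> tc; have [h|h] := ltP 0 (tnth (fold x) j); [left; apply/andP|right => /=].
Qed.

Lemma multiplier_set_measurable (A : set T) : measurable A -> multiplier_set A.
Proof.
apply: smallest_sub.
  split.
  - exact: multiplier_set0.
  - by move=> B SB; rewrite setTD; exact: multiplier_setC.
  - by move=> B SB; exact: multiplier_bigcup.
have H (X : set T) : (\big[setU/set0]_(i < d)
    preimage_set_system setT (fun x : T => tnth x i) measurable) X ->
    exists i, preimage_set_system setT (fun x : T => tnth x i) measurable X.
  elim/big_ind : _ => [[]|S1 S2 h1 h2 [/h1|/h2]//|i _ HX]; by exists i.
move=> X /H[i [B mB <-]]; rewrite setTI.
exact: multiplier_set_tnth.
Qed.

Import HBNNSimple.

(** Simple functions increase to g, and each of them is a finite combination of indicators acting on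
    the constant 1. *)
Lemma trig_approx_ge0 (g : T -> R) : measurable_fun setT g -> (forall x, 0 <= g x) ->
  square_integrable P (fun x => (g x)%:C%C) -> trig_approx (fun x => (g (fold x))%:C%C).
Proof.
move=> mg g0 gi.
have mgE : measurable_fun setT (EFin \o g) by exact/measurable_EFinP.
pose g_ := nnsfun_approx measurableT mgE.
have gE x : g_ n x @[n --> \oo] --> g x.
  have := cvg_nnsfun_approx measurableT mgE (fun x _ => g0 x) (I : setT x).
  by move=> /fine_cvgP[].
have g_le n x : g_ n x <= g x.
  have := le_approx n (fun x _ => g0 x : 0 <= (EFin \o g) x)%E (I : setT x).
  by rewrite /g_ nnsfun_approxE lee_fin.
have gn0 n x : 0 <= g_ n x by exact: fun_ge0.
have mfold := measurable_shift (fun=> 0) : measurable_fun setT fold.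
have fi : square_integrable P (fun x => (g (fold x))%:C%C) := square_integrable_shift _ gi.
apply: trig_approx_limit => // e e0.
pose G n x := sqnorm ((g (fold x))%:C%C - (g_ n (fold x))%:C%C : R[i]).
have GE n x : G n x = (g (fold x) - g_ n (fold x)) ^+ 2.
  by rewrite /G -rmorphB sqnorm_real.
have mgn n : measurable_fun setT (g_ n) by exact: measurable_funP.
have [n Hn] : exists n, (\int[P]_x (G n x)%:E < e%:E)%E.
  apply: (@dominated_small _ _ _ _ _ (fun x => (sqnorm ((g (fold x))%:C%C : R[i]))%:E)%E) => //.
  - move=> n; rewrite (funext (GE n)); apply: measurable_funX; apply: measurable_funB.
      exact: (measurableT_comp mg mfold).
    exact: (measurableT_comp (mgn n) mfold).
  - by move=> n x; exact: sqnorm_ge0.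
  - move=> x; have h : g (fold x) - g_ n (fold x) @[n --> \oo] --> (0 : R).
      by rewrite -[X in _ --> X](subrr (g (fold x))); apply: cvgB; [exact: cvg_cst|exact: gE].
    rewrite (_ : (fun n => G n x) =
      (fun n => (g (fold x) - g_ n (fold x)) * (g (fold x) - g_ n (fold x)))); last first.
      by apply/funext => n; rewrite GE expr2.
    by have := cvgM h h; rewrite !mul0r; exact.
  - exact: integrable_sqnorm.
  - move=> n x; rewrite lee_fin GE sqnorm_real.
    have h1 := g_le n (fold x); have h2 := gn0 n (fold x); have h3 := g0 (fold x).
    by rewrite lerXn2r ?nnegrE//; lra.
exists (fun x => (g_ n (fold x))%:C%C); split => //.
pose D := finmap.enum_fset (fset_set (range (g_ n))).
rewrite (_ : (fun x => _) = fun x => \sum_(r <- D) r%:C%C *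
  ((\1_(g_ n @^-1` [set r]) (fold x))%:C%C * 1)); last first.
  apply/funext => x; rewrite [in LHS]fimfunE fsbig_finite// -/D rmorph_sum/=.
  by apply: eq_bigr => r _; rewrite mulr1 rmorphM.
elim: D => [|r s IH].
  under eq_fun do rewrite big_nil -(mul0r 1); apply: trig_approxZ; exact: trig_approx1.
under eq_fun do rewrite big_cons; apply: trig_approxD => //; apply: trig_approxZ.
have mr : measurable (g_ n @^-1` [set r]) by exact: measurable_funPTI.
by have [_ _ H] := multiplier_set_measurable mr; apply: H; exact: trig_approx1.
Qed.

(** Completeness, by splitting f into the positive and negative parts of its real and imaginary
    parts. *)
Lemma trig_approx_fold (f : T -> R[i]) : square_integrable P f -> trig_approx (fun x => f (fold x)).
Proof.
move=> fi; have [[m1 m2] _] := fi.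
have pos (u : T -> R) : measurable_fun setT u -> (forall x, (u x) ^+ 2 <= sqnorm (f x)) ->
    trig_approx (fun x => (u (fold x))%:C%C).
  move=> mu uf.
  have h (v : T -> R) : measurable_fun setT v -> (forall x, 0 <= v x <= `|u x|) ->
    trig_approx (fun x => (v (fold x))%:C%C).
    move=> mv vu; apply: trig_approx_ge0 => //; first by move=> x; case/andP: (vu x).
    case: fi => mf ff; apply: (square_integrable_le _ _ (measurable_sqnorm mf) ff).
      exact: cmeasurable_real.
    move=> x; rewrite lee_fin sqnorm_real (le_trans _ (uf x))// -(real_normK (num_real (u x))).
    by have /andP[v0 v1] := vu x; rewrite lerXn2r ?nnegrE.
  rewrite (_ : (fun x => _) = fun x => (u^\+ (fold x))%:C%C + (- 1) * (u^\- (fold x))%:C%C).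
    apply: trig_approxD; last apply: trig_approxZ.
      apply: h; first exact: measurable_funrpos.
      by move=> x; rewrite funrpos_ge0/= ge_max ler_norm normr_ge0.
    apply: h; first exact: measurable_funrneg.
    by move=> x; rewrite funrneg_ge0/= ge_max -normrN ler_norm normr_ge0.
  by apply/funext => x; rewrite mulN1r -rmorphB/= -[in LHS](funrposBneg u).
rewrite (_ : (fun x => _) = fun x => (complex.Re (f (fold x)))%:C%C + 'i%C *
  (complex.Im (f (fold x)))%:C%C).
  apply: trig_approxD; last apply: trig_approxZ.
    by apply: (pos (fun x => complex.Re (f x))) => // x; rewrite /sqnorm lerDl sqr_ge0.
  by apply: (pos (fun x => complex.Im (f x))) => // x; rewrite /sqnorm lerDr sqr_ge0.
by apply/funext => x; exact: complexE.
Qed.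

End measurable_sets_approx.

(** * Bessel inequality and the error of the lattice rule *)

Section parseval.
Variables (R : realType) (d : nat).
Notation P := (cube R d).
Notation T := (d.-tuple R).
Implicit Types (f : T -> R[i]) (h : 'rV[int]_d).

Lemma fourier_coef_shift f h (a : 'I_d -> R) : square_integrable P f ->
  fourier_coef (fun x => f (shift a x)) h =
  cexp (2 * pi * \sum_(j < d) (h 0 j)%:~R * a j) * fourier_coef f h.
Proof.
move=> fi; rewrite !fourier_coefE; set w := cexp _.
have ie : square_integrable P (fun x => (echar h x)^*%C).
  rewrite (_ : (fun x => _) = echar (- h)); last by apply/funext => x; rewrite echarN.
  exact: square_integrable_echar.
have mfe : cmeasurable (fun x => f x * (echar h x)^*%C).
  by case: fi ie => mf _ [me _]; exact: cmeasurableM.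
rewrite -(cintegral_shift a mfe) -cintegralZ; last first.
  apply: (@cintegrableM _ _ _ P (fun x => f (shift a x)) (fun x => (echar h (shift a x))^*%C)).
    exact: square_integrable_shift.
  exact: (square_integrable_shift a ie).
apply: eq_cintegral => x; rewrite echar_shift -/w rmorphM/= mulrCA (mulrA w) cexpJM mul1r.
by [].
Qed.

(** Orthogonality needs each frequency once: equal frequencies are merged by adding their
    coefficients. *)
Lemma trigpolyE (s : seq (R[i] * 'rV[int]_d)) : let S := undup [seq p.2 | p <- s] in
  trigpoly s = fun x => \sum_(h <- S) (\sum_(p <- s | p.2 == h) p.1) * echar h x.
Proof.
move=> S; apply/funext => x; under eq_bigr do rewrite mulr_suml.
rewrite (exchange_big_dep xpredT)//=; apply: eq_big_seq => p ps.
rewrite (eq_bigl (pred1 p.2)); last by move=> h; rewrite /= eq_sym.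
by rewrite -big_filter filter_pred1_uniq ?undup_uniq// ?big_seq1// mem_undup map_f.
Qed.

(** For the trigonometric sum q with coefficients c, expanding the square gives ||f - q||^2 =
    ||f||^2 - sum |f^(h)|^2 + sum |f^(h) - c h|^2 over S; the last sum is dropped. *)
Lemma parseval_dist f (S : seq 'rV[int]_d) (c : 'rV[int]_d -> R[i]) :
  uniq S -> square_integrable P f ->
  (\int[P]_x (sqnorm (f x))%:E <=
   sqdist P f (fun x => \sum_(h <- S) c h * echar h x)%R +
     (\sum_(h <- S) sqnorm (fourier_coef f h))%:E)%E.
Proof.
move=> uS fi; set q := fun x => \sum_(h <- S) c h * echar h x.
have qi : square_integrable P q.
  by apply: square_integrable_sum => h; apply: square_integrableZ; exact: square_integrable_echar.
have fqi : square_integrable P (fun x => f x - q x) by exact: square_integrableB.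
have Ji g : square_integrable P g -> square_integrable P (fun x => (g x)^*%C).
  move=> [mg gi]; split; first exact: cmeasurableJ.
  by rewrite (eq_integral (fun x => (sqnorm (g x))%:E))// => x _; rewrite /sqnorm !partsE sqrrN.
have sqE g : square_integrable P g ->
    (\int[P]_x (sqnorm (g x))%:E = (complex.Re (cintegral P (fun x => g x * (g x)^*%C)))%:E)%E.
  move=> gi; rewrite Re_cintegral (@eq_Rintegral _ _ _ P setT (fun x => sqnorm (g x)));
    last by move=> x _; rewrite mulcJ.
  by rewrite /Rintegral fineK//; apply: integrable_fin_num => //; exact: integrable_sqnorm.
rewrite /sqdist (sqE _ fqi) (sqE _ fi) -EFinD lee_fin.
have ee h g : square_integrable P g -> cintegrable P (fun x => g x * (echar h x)^*%C).
  by move=> gi; apply: cintegrableM => //; apply: Ji; exact: square_integrable_echar.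
have qJ g : square_integrable P g ->
    cintegral P (fun x => g x * (q x)^*%C) = \sum_(h <- S) (c h)^*%C * fourier_coef g h.
  move=> gi; rewrite (@eq_cintegral _ _ _ _ (fun x => \sum_(h <- S) (c h)^*%C *
    (g x * (echar h x)^*%C))).
    rewrite cintegral_sum; last by move=> h; apply: cintegrableZ; exact: ee.
    by apply: eq_bigr => h _; rewrite cintegralZ ?fourier_coefE//; exact: ee.
  move=> x; rewrite /q rmorph_sum mulr_sumr; apply: eq_bigr => h _; rewrite rmorphM/=; ring.
have qhat h : h \in S -> fourier_coef q h = c h.
  move=> hS; rewrite fourier_coefE.
  rewrite (@eq_cintegral _ _ _ _ (fun x => \sum_(k <- S) c k * (echar k x * (echar h x)^*%C))).
    rewrite cintegral_sum; last first.
      by move=> k; apply: cintegrableZ; apply: ee; exact: square_integrable_echar.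
    rewrite (eq_bigr (fun k => c k * (k == h)%:R)); last first.
      move=> k _; rewrite cintegralZ ?echar_orthonormal//.
      by apply: ee; exact: square_integrable_echar.
    rewrite (bigD1_seq h)//= eqxx mulr1 big1_seq ?addr0//.
    by move=> k /andP[/negbTE -> _]; rewrite mulr0.
  by move=> x; rewrite /q mulr_suml; apply: eq_bigr => k _; rewrite mulrA.
have -> : cintegral P (fun x => (f x - q x) * (f x - q x)^*%C) =
  cintegral P (fun x => f x * (f x)^*%C) - cintegral P (fun x => f x * (q x)^*%C)
  - (cintegral P (fun x => f x * (q x)^*%C))^*%C + cintegral P (fun x => q x * (q x)^*%C).
  have i1 := cintegrableM fi (Ji _ fi); have i2 := cintegrableM fi (Ji _ qi).
  have i3 := cintegrableM qi (Ji _ qi); have i4 := cintegrableM qi (Ji _ fi).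
  rewrite -cintegralJ// (@eq_cintegral _ _ _ _ (fun x => q x * (f x)^*%C) (fun x =>
    (f x * (q x)^*%C)^*%C)); last first.
    by move=> x; rewrite rmorphM/= conjcK mulrC.
  rewrite [LHS](@eq_cintegral _ _ _ _
    (fun x => (f x * (f x)^*%C + (-1) * (f x * (q x)^*%C)) +
    ((-1) * (q x * (f x)^*%C) + q x * (q x)^*%C))).
    have j2 := cintegrableZ (-1) i2; have j4 := cintegrableZ (-1) i4.
    rewrite (cintegralD (cintegrableD i1 j2) (cintegrableD j4 i3)).
    by rewrite (cintegralD i1 j2) (cintegralD j4 i3) !cintegralZ// !mulN1r addrA.
  by move=> x; rewrite rmorphB/=; ring.
rewrite !qJ//; set A := fun h => fourier_coef f h.
have E2 : complex.Re (\sum_(h <- S) (c h)^*%C * fourier_coef q h) = \sum_(h <- S) sqnorm (c h).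
  by rewrite Re_sum; apply: eq_big_seq => h hS; rewrite qhat// mulrC mulcJ.
have K : \sum_(h <- S) sqnorm (A h - c h) = \sum_(h <- S) sqnorm (c h) + \sum_(h <- S) sqnorm (A h)
    - 2 * complex.Re (\sum_(h <- S) (c h)^*%C * fourier_coef f h).
  rewrite Re_sum mulr_sumr -sumrN -!big_split/=; apply: eq_bigr => h _.
  by rewrite /sqnorm !partsE /A; ring.
have K0 : 0 <= \sum_(h <- S) sqnorm (A h - c h) by apply: sumr_ge0 => h _; exact: sqnorm_ge0.
rewrite K in K0; rewrite !(ReD, ReN, ReJ) E2 -/(A) in K0 *.
move: K0; rewrite /A; lra.
Qed.

Lemma parseval_le f : in_L2 f ->
  (\int[P]_x (sqnorm (f x))%:E <= \esum_(h in [set: 'rV[int]_d]) (sqnorm (fourier_coef f h))%:E)%E.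
Proof.
move=> [m1 m2 f2]; have fi : square_integrable P f by split.
(* The reduction of f modulo 1 has the same norm and the same Fourier coefficients as f, and
   completeness applies to it. *)
pose F x := f (shift (fun=> 0) x).
have Fi : square_integrable P F by exact: square_integrable_shift.
rewrite -(@ge0_integral_shift _ _ (fun=> 0) (fun x => (sqnorm (f x))%:E)); first last.
- by move=> x; rewrite lee_fin sqnorm_ge0.
- exact: measurable_sqnorm.
have Fc h : fourier_coef F h = fourier_coef f h.
  rewrite fourier_coef_shift// big1 ?mulr0 ?cexp0 ?mul1r// => j _; by rewrite mulr0.
apply/lee_addgt0Pr => e e0.
have [_ /(_ e e0)[s]] := trig_approx_fold fi.
rewrite trigpolyE; set S := undup _ => /ltW Hs.
have uS : uniq S by exact: undup_uniq.
apply: (le_trans (parseval_dist (fun h => \sum_(p <- s | p.2 == h) p.1) uS Fi)).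
rewrite addeC; apply: leeD => //.
apply: esum_ge; exists [set` S]; first by split => //; exact: finite_seq.
rewrite -fsbig_seq//= sumEFin lee_fin ler_sum// => h _.
by rewrite Fc.
Qed.

End parseval.

(** * Variance of the randomly shifted lattice rule *)

Section lattice_variance.
Variables (R : realType) (d : nat).
Notation P := (cube R d).
Notation T := (d.-tuple R).

Definition dotz (h z : 'rV[int]_d) : int := \sum_(j < d) h 0 j * z 0 j.

Lemma lattice_ruleE (p : nat) (z : 'rV[int]_d) (f : T -> R[i]) (x : T) :
  lattice_rule p z x f =
  \sum_(k < p) (p%:R)^-1 * f (shift (fun j => (z 0 j)%:~R * k%:R / p%:R) x).
Proof. by rewrite /lattice_rule mulr_sumr. Qed.

Lemma square_integrable_lattice_rule (p : nat) (z : 'rV[int]_d) (f : T -> R[i]) :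
  square_integrable P f -> square_integrable P (fun x => lattice_rule p z x f).
Proof.
move=> fi; under eq_fun do rewrite lattice_ruleE.
apply: square_integrable_sum => k; apply: square_integrableZ; exact: square_integrable_shift.
Qed.

Lemma cexp_div_neq1 (p : nat) (m : int) : (0 < p)%N -> ~~ (p %| m)%Z ->
  cexp (2 * pi * (m%:~R / p%:R)) != 1 :> R[i].
Proof.
move=> p0 pm; pose r := (m %% p)%Z.
have pz : (p : int) != 0 by rewrite -lt0n in p0 *; lia.
have r0 : 0 < r < p.
  by rewrite ltz_pmod ?andbT// lt0r modz_ge0// andbT; apply: contra pm;
    rewrite -/r => /eqP/dvdz_mod0P.
have pR : (p%:R : R) != 0 by rewrite pnatr_eq0 -lt0n.
have -> : (m%:~R / p%:R : R) = (m %/ p)%Z%:~R + r%:~R / p%:R.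
  rewrite {1}(divz_eq m p) intrD intrM -/r mulrDl; congr (_ + _).
  by rewrite -[((Posz p)%:~R : R)]/(p%:R) mulfK.
rewrite mulrDr cexpD cexp_2pi_int mul1r.
set t := (_ / _); have /andP[t0 t1] : 0 < t < 1.
  case/andP: r0 => r1 r2; apply/andP; split.
    by apply: divr_gt0; rewrite ?ltr0n// ltr0z.
  by rewrite ltr_pdivrMr ?ltr0n// mul1r -[X in _ < X]/((Posz p)%:~R) ltr_int.
(* By cos(2 pi t) = cos^2(pi t) - sin^2(pi t), the value 1 would force sin(pi t) = 0. *)
have s0 : 0 < sin (pi * t).
  apply: sin_gt0_pi; apply/andP; split; first by apply: mulr_gt0 => //; exact: pi_gt0.
  by rewrite -[ltRHS]mulr1 ltr_pM2l ?pi_gt0.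
apply/negP => /eqP/(congr1 (@complex.Re R)) /=.
rewrite (_ : 2 * pi * t = pi * t + pi * t); last by ring.
rewrite cosD -!expr2 => E; have := cos2Dsin2 (pi * t); have := mulr_gt0 s0 s0.
by rewrite -expr2; lra.
Qed.

(** The ratio w of this geometric sum satisfies w^p = 1, so the sum vanishes unless w = 1, that is,
    unless p | m. *)
Lemma sum_cexp_div (p : nat) (m : int) : (0 < p)%N ->
  \sum_(k < p) (p%:R)^-1 * cexp (2 * pi * (m%:~R * k%:R / p%:R)) = ((p %| m)%Z)%:R :> R[i].
Proof.
move=> p0; have pR : (p%:R : R[i]) != 0 by rewrite pnatr_eq0 -lt0n.
have pR' : (p%:R : R) != 0 by rewrite pnatr_eq0 -lt0n.
pose w : R[i] := cexp (2 * pi * (m%:~R / p%:R)).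
rewrite (eq_bigr (fun k : 'I_p => (p%:R)^-1 * w ^+ k)); last first.
  by move=> k _; rewrite -cexp_natmul; congr (_ * cexp _); ring.
rewrite -mulr_sumr; case: (boolP (p %| m)%Z) => pm.
  have w1 : w = 1.
    case/dvdzP: pm => q mq; rewrite /w mq intrM -[((Posz p)%:~R : R)]/(p%:R) mulfK//.
    exact: cexp_2pi_int.
  under eq_bigr do rewrite w1 expr1n.
  by rewrite sumr_const card_ord mulVf.
have wp : w ^+ p = 1.
  by rewrite -cexp_natmul -mulrA divfK// cexp_2pi_int.
have := subrX1 w p; rewrite wp subrr => /esym/eqP.
rewrite mulf_eq0 subr_eq0 (negbTE (cexp_div_neq1 p0 pm))/= => /eqP ->.
by rewrite mulr0.
Qed.

(** As a function of the shift, the error has the Fourier coefficients ([p | h.z] - [h = 0]) f^(h).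
    The term h = 0 cancels, and [parseval_le] applies to the error itself. *)
Lemma lattice_variance_le (p : nat) (z : 'rV[int]_d) (f : T -> R[i]) : (0 < p)%N -> in_L2 f ->
  (\int[P]_x (sqnorm (lattice_rule p z x f - integral_cube f))%:E <=
   \esum_(h in [set h : 'rV[int]_d | h != 0%R])
     (((p %| dotz h z)%Z)%:R * sqnorm (fourier_coef f h))%:E)%E.
Proof.
move=> p0 f2; have fi : square_integrable P f by case: f2 => m1 m2 f2; split.
have Qi := square_integrable_lattice_rule p z fi.
pose g x := lattice_rule p z x f - integral_cube f.
have gi : square_integrable P g by apply: square_integrableB => //; exact: square_integrable_cst.
have g2 : in_L2 g by case: gi => -[m1 m2] ?; split.
apply: (le_trans (parseval_le g2)).
have ei h : square_integrable P (fun x => (echar h x)^*%C).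
  rewrite (_ : (fun x => _) = echar (- h)); last by apply/funext => x; rewrite echarN.
  exact: square_integrable_echar.
have gh h : fourier_coef g h = (((p %| dotz h z)%Z)%:R - (h == 0)%:R) * fourier_coef f h.
  have -> : fourier_coef g h = \sum_(k < p) (p%:R)^-1 *
      fourier_coef (fun x => f (shift (fun j => (z 0 j)%:~R * k%:R / p%:R) x)) h
      + - integral_cube f * cintegral P (fun x => (echar h x)^*%C).
    rewrite !fourier_coefE -cintegralZ; last exact: square_cintegrable.
    under eq_bigr => k _ do rewrite fourier_coefE.
    have ii (k : 'I_p) : cintegrable P (fun x => f (shift (fun j => (z 0 j)%:~R * k%:R / p%:R) x) *
      (echar h x)^*%C).
      by apply: cintegrableM => //; exact: square_integrable_shift.
    rewrite (eq_bigr (fun k : 'I_p => cintegral P (fun x => (p%:R)^-1 *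
       (f (shift (fun j => (z 0 j)%:~R * k%:R / p%:R) x) * (echar h x)^*%C)))); last first.
      by move=> k _; rewrite cintegralZ.
    rewrite -cintegral_sum; last by move=> k; exact: cintegrableZ.
    rewrite -cintegralD; last 2 first.
      by apply: cintegrable_sum => k; exact: cintegrableZ.
      by apply: cintegrableZ; exact: square_cintegrable.
    apply: eq_cintegral => x; rewrite /g lattice_ruleE mulrBl mulNr mulr_suml; congr (_ - _).
    by apply: eq_bigr => k _; rewrite mulrA.
  rewrite mulrBl; congr (_ + _).
    rewrite -(sum_cexp_div _ p0) mulr_suml; apply: eq_bigr => k _.
    rewrite fourier_coef_shift// mulrA; congr (_ * cexp (_ * _) * _).
    rewrite /dotz (raddf_sum (intr : int -> R)) !mulr_suml; apply: eq_bigr => j _.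
    by rewrite /= intrM; ring.
  rewrite (@eq_cintegral _ _ _ _ (echar (- h))); last by move=> x; rewrite echarN.
  rewrite cintegral_echar oppr_eq0 mulNr; congr (- _).
  case: eqP => [->|_]; last by rewrite mulr0 mul0r.
  rewrite mulr1 mul1r fourier_coefE; apply: eq_cintegral => x.
  by rewrite echar0 conjc1 mulr1.
rewrite [leRHS]esum_mkcond; apply: le_esum => h _; rewrite gh.
case: ifPn => [|]; rewrite ?inE ?notin_setE/=.
  move=> /negbTE ->; rewrite subr0 sqnormM; case: (_ %| _)%Z => //=.
    by rewrite -[sqnorm 1]/(sqnorm (1%:C%C)) sqnorm_real expr1n.
  by rewrite sqnorm0.
move=> /negP; rewrite negbK => /eqP ->.
rewrite eqxx (_ : (p %| dotz 0 z)%Z) ?subrr ?mul0r ?sqnorm0//.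
by rewrite /dotz big1 ?dvdz0// => j _; rewrite mxE mul0r.
Qed.

End lattice_variance.

(** * Averaging over the primes: the root mean square error *)

Section rms.
Variables (R : realType) (d n : nat).
Notation P := (cube R d).
Notation T := (d.-tuple R).
Let s := primes_upper_half n.

Lemma primes_upper_half_uniq : uniq (primes_upper_half n).
Proof. by rewrite filter_uniq// iota_uniq. Qed.

Lemma counting_seq (t : seq nat) (U : set nat) : uniq t ->
  counting (U `&` [set` t]) = (\sum_(p <- t) \d_p U)%E :> \bar R.
Proof.
move=> ut; rewrite counting_dirac nneseries_esumT//.
transitivity (\esum_(i in [set` t]) (\d_i U : \bar R)).
  rewrite [RHS]esum_mkcond; apply: eq_esum => i _; rewrite !diracE in_setI.
  by case: (i \in [set` t]); rewrite ?andbT ?andbF.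
by rewrite esum_fset -?fsbig_seq//; exact: finite_seq.
Qed.

Lemma uniform_primesE (U : set nat) : (0 < size s)%N ->
  uniform_primes R n U = ((size s)%:R^-1%:E * \sum_(p <- s) \d_p U)%E.
Proof.
move=> s0; pose mr (V : set nat) : \bar R := counting (V `&` [set` s]).
(* This is [mnormalize] unfolded: as [s] is not empty, the total mass is neither 0 nor infinite and
   the default measure is not reached. *)
rewrite -[LHS]/((if (mr setT == 0%E) || (mr setT == +oo%E) then (fun V => \d_0%N V)
   else fun V => (mr V * ((fine (mr setT))^-1)%:E)%E) U).
have E V : mr V = (\sum_(p <- s) \d_p V)%E by rewrite /mr counting_seq// primes_upper_half_uniq.
rewrite !E.
have -> : (\sum_(p <- s) \d_p [set: nat])%E = ((size s)%:R)%:E :> \bar R.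
  rewrite (eq_bigr (fun=> 1%:E)); last by move=> p _; rewrite diracT.
  by rewrite sumEFin big_const_seq count_predT iter_addr_0.
by rewrite eqe pnatr_eq0 -leqn0 leqNgt s0 /= E muleC.
Qed.

Lemma integral_uniform_primes (G : nat -> \bar R) : (0 < size s)%N -> (forall p, (0 <= G p)%E) ->
  (\int[uniform_primes R n]_p G p = (size s)%:R^-1%:E * \sum_(p <- s) G p)%E.
Proof.
move=> s0 G0.
pose m_ i : {measure set nat -> \bar R} := \d_(nth 0%N s i).
have k0 : 0 <= ((size s)%:R^-1 : R) by rewrite invr_ge0.
pose k := NngNum k0.
transitivity (\int[mscale k (msum m_ (size s))]_p G p)%E.
  apply: eq_measure_integral => U _ _; rewrite [LHS]uniform_primesE// /mscale/= /msum.
  by rewrite (big_nth 0%N) big_mkord.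
rewrite ge0_integral_mscale// ge0_integral_measure_sum//; congr (_ * _)%E.
rewrite (big_nth 0%N) big_mkord; apply: eq_bigr => i _.
by rewrite integral_dirac// diracT mul1e.
Qed.

(** A preimage is the countable union of its slices over the integers. *)
Lemma measurable_fun_nat_prod (g : nat -> T -> \bar R) : (forall p, measurable_fun setT (g p)) ->
  measurable_fun setT (fun w : nat * T => g w.1 w.2).
Proof.
move=> mg _ A mA; rewrite setTI.
rewrite (_ : _ @^-1` A = \bigcup_p ([set p] `*` (g p @^-1` A))); last first.
  by apply/seteqP; split => [[p x] /= h|[p x] [q _ [/= -> ]]//]; exists p.
apply: bigcup_measurable => p _; apply: measurableX => //.
by rewrite -[X in measurable X]setTI; exact: mg.
Qed.

Lemma expectation_ran_pr_sh (z : 'rV[int]_d) (f : T -> R[i]) : (0 < size s)%N -> in_L2 f ->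
  ('E_(ran_pr_sh_prob R d n)[(fun w => sqnorm (ran_pr_sh z f w - integral_cube f))%R] =
   (size s)%:R^-1%:E * \sum_(p <- s) \int[P]_x (sqnorm (lattice_rule p z x f -
     integral_cube f))%:E)%E.
Proof.
move=> s0 f2; have fi : square_integrable P f by case: f2 => m1 m2 f2; split.
rewrite unlock /ran_pr_sh_prob.
pose g (p : nat) (x : T) : \bar R := (sqnorm (lattice_rule p z x f - integral_cube f))%:E.
have mg : measurable_fun setT (fun w : nat * T => g w.1 w.2).
  apply: measurable_fun_nat_prod => p; apply: measurable_sqnorm; apply: cmeasurableB;
    last exact: cmeasurable_cst.
  by case: (square_integrable_lattice_rule p z fi).
rewrite (fubini_tonelli1 (fun w => g w.1 w.2))//; last by move=> w; rewrite lee_fin sqnorm_ge0.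
rewrite integral_uniform_primes// => p.
by apply: integral_ge0 => x _; rewrite lee_fin sqnorm_ge0.
Qed.

(** Exchanging the sums over p and h gives each |f^(h)|^2 the factor k(h) / |P_n|, and the
    hypothesis compares the result term by term with the Korobov norm. *)
Lemma rms_error_le (gamma : set nat -> R) (alpha : R) (z : 'rV[int]_d) (B : R) :
  (0 < size s)%N -> 0 <= B -> (forall h : 'rV[int]_d, 0 < rweight gamma alpha h) ->
  (forall h : 'rV[int]_d, h != 0 ->
     (count (fun p : nat => (p %| dotz h z)%Z) s)%:R / (size s)%:R <= B ^+ 2 *
       rweight gamma alpha h ^+ 2) ->
  (rms_error gamma alpha (ran_pr_sh_prob R d n) (@ran_pr_sh R d z) <= B%:E)%E.
Proof.
move=> s0 B0 rw0 H; apply: ub_ereal_sup => _ [f [[f2 _] f1] <-].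
have {}f1 : (\esum_(h in [set: 'rV[int]_d])
    (sqnorm (fourier_coef f h) * rweight gamma alpha h ^+ 2)%:E <= 1)%E.
  rewrite -lee_sqrt// (_ : sqrte 1 = 1%E)//.
  by rewrite /= sqrtr1.
have -> : B%:E = sqrte ((B ^+ 2)%:E) by rewrite /= sqrtr_sqr ger0_norm.
rewrite lee_sqrt ?lee_fin ?sqr_ge0// expectation_ran_pr_sh//.
apply: (@le_trans _ _ ((size s)%:R^-1%:E *
  \sum_(p <- s) \esum_(h in [set h : 'rV[int]_d | h != 0%R])
     (((p %| dotz h z)%Z)%:R * sqnorm (fourier_coef f h))%:E)%E).
  rewrite lee_pmul2l ?lte_fin ?invr_gt0 ?ltr0n// big_seq [leRHS]big_seq.
  apply: lee_sum => p ps; apply: lattice_variance_le => //.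
  by move: ps; rewrite mem_filter => /andP[/andP[/prime_gt0]].
rewrite -esum_sum; last by move=> h p _ _; rewrite lee_fin mulr_ge0// sqnorm_ge0.
rewrite muleC -lee_pdivlMr ?invr_gt0 ?ltr0n// invrK.
apply: ub_ereal_sup => _ [X [finX XS] <-].
rewrite fsbig_finite//=.
have E h : (\sum_(p <- s) (((p %| dotz h z)%Z)%:R * sqnorm (fourier_coef f h))%:E)%E =
    ((count (fun p : nat => (p %| dotz h z)%Z) s)%:R * sqnorm (fourier_coef f h))%:E.
  rewrite sumEFin -mulr_suml; congr (_ * _)%:E.
  by rewrite -sum1_count natr_sum [RHS]big_mkcond; apply: eq_bigr => p _; case: ifP.
under eq_bigr do rewrite E.
apply: (@le_trans _ _ ((B ^+ 2 * (size s)%:R)%:E * \sum_(h <- finmap.enum_fset (fset_set X))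
   (sqnorm (fourier_coef f h) * rweight gamma alpha h ^+ 2)%:E)%E).
  rewrite !sumEFin -EFinM lee_fin mulr_sumr big_seq [leRHS]big_seq; apply: ler_sum => h.
  rewrite in_fset_set// inE => /XS /= h0.
  have := H _ h0; rewrite ler_pdivrMr ?ltr0n// => Hh.
  rewrite [leRHS](_ : _ = (B ^+ 2 * rweight gamma alpha h ^+ 2 * (size s)%:R) *
    sqnorm (fourier_coef f h)); last by ring.
  by rewrite ler_wpM2r// sqnorm_ge0.
rewrite -[leRHS]mule1 EFinM muleC -EFinM mulrC muleC lee_wpmul2l ?lee_fin ?mulr_ge0 ?sqr_ge0//.
apply: le_trans f1; apply: esum_ge; exists X => //.
by rewrite fsbig_finite.
Qed.

End rms.

(** * The choice of the generating vector *)

Section low_elements.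
Variables (R : realType) (T : choiceType) (Q : pred T) (w : T -> R).

(* The elements of rank at most j when Q is ordered by increasing w, ties being
   counted against the element. *)
Definition low (j : nat) (x : T) : Prop :=
  Q x /\ forall t, uniq t -> all Q t -> (forall y, y \in t -> w y <= w x) -> (size t <= j)%N.

Lemma seq_argmax (t : seq T) : t != [::] -> exists2 x, x \in t & forall y, y \in t -> w y <= w x.
Proof.
elim: t => // a [|b t] IH _; first by exists a; [rewrite mem_head|move=> y /[!inE] /eqP ->].
have [x xt Hx] := IH isT; have [wa|wa] := leP (w a) (w x).
  by exists x; [rewrite inE xt orbT|move=> y; rewrite in_cons => /orP[/eqP ->//|/Hx]].
exists a; first exact: mem_head.
by move=> y; rewrite in_cons => /orP[/eqP ->//|/Hx/le_trans]; apply; exact: ltW.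
Qed.

(** An element of [t] with the largest weight is itself low, and all of [t] counts against it. *)
Lemma low_size (j : nat) (t : seq T) : uniq t -> (forall y, y \in t -> low j y) -> (size t <= j)%N.
Proof.
move=> ut lt; have [->//|t0] := eqVneq t [::].
have [x xt Hx] := seq_argmax t0; have [_] := lt _ xt; apply => //.
by apply/allP => y /lt[].
Qed.

(** Lists of low elements have bounded length, and one of maximal length must contain every low
    element. *)
Lemma low_enum (j : nat) : exists t, [/\ uniq t, (size t <= j)%N & forall x, low j x -> x \in t].
Proof.
pose S k := `[< exists t, [/\ uniq t, size t = k & forall y, y \in t -> low j y] >].
have S0 : exists k, S k by exists 0%N; apply/asboolP; exists [::].
have Sj k : S k -> (k <= j)%N by move=> /asboolP[t [ut <- lt]]; exact: low_size.
have [k /asboolP[t [ut tk lt]] Hk] := ex_maxnP S0 Sj.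
exists t; split; [by []|by rewrite tk; apply: Sj; apply/asboolP; exists t|].
move=> x lx; apply/negPn/negP => xt.
have /Hk : S k.+1.
  apply/asboolP; exists (x :: t); split => /=; rewrite ?xt ?ut ?tk//.
  by move=> y; rewrite in_cons => /orP[/eqP ->|/lt].
by rewrite ltnn.
Qed.

Lemma not_low (j : nat) (x : T) : Q x -> ~ low j x ->
  exists t, [/\ uniq t, all Q t, (forall y, y \in t -> w y <= w x) & size t = j.+1].
Proof.
move=> Qx /not_andP[//|/existsNP[t]] /not_implyP[ut] /not_implyP[Qt] /not_implyP[wt] /negP.
rewrite -ltnNge => jt; exists (take j.+1 t); split.
- exact: take_uniq.
- by apply/allP => y /mem_take; exact: (allP Qt).
- by move=> y /mem_take; exact: wt.
- by rewrite size_takel.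
Qed.

End low_elements.

Lemma exists_le_average (R : realFieldType) (V : finType) (G : {set V}) (g : V -> R) (c : R) :
  G != finset.set0 -> \sum_(u in G) g u <= #|G|%:R * c -> exists2 u, u \in G & g u <= c.
Proof.
move=> G0 H; apply/exists_inP; apply: contraT; rewrite negb_exists_in => /forall_inP K.
suff : #|G|%:R * c < \sum_(u in G) g u by rewrite ltNge H.
have [u uG] : exists u, u \in G by exact/finset.set0Pn.
rewrite (bigD1 u)//= mulr_natl (cardD1 u) uG mulrS; apply: ltr_leD.
  by rewrite ltNge K.
rewrite -sumr_const; apply: (@le_trans _ _ (\sum_(i in G | i != u) c)).
  by rewrite le_eqVlt; apply/orP; left; apply/eqP; apply: eq_bigl => i; rewrite !inE andbC.
by apply: ler_sum => i /andP[iG _]; rewrite ltW// ltNge K.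
Qed.

(* Method of conditional expectations for independent v i uniform in G i; the
   weights w carry the factors that are already fixed. *)
Lemma averaging_choice (R : realFieldType) (X : Type) (V : finType) (v0 : V) (G : nat -> {set V})
    (I : seq X) (f : X -> nat -> V -> R) (m : nat) (w : X -> R) :
  (forall i, (i < m)%N -> G i != finset.set0) ->
  exists v : nat -> V, (forall i, (i < m)%N -> v i \in G i) /\
   \sum_(x <- I) w x * \prod_(i < m) f x i (v i) <=
   \sum_(x <- I) w x * \prod_(i < m) ((\sum_(u in G i) f x i u) / #|G i|%:R).
Proof.
elim: m w => [|m IH] w G0.
  by exists (fun=> v0); split => //; apply: ler_sum => x _; rewrite !big_ord0.
pose avg x i := (\sum_(u in G i) f x i u) / #|G i|%:R.
have Gm := G0 m (ltnSn m).
have cm : (#|G m|%:R : R) != 0 by rewrite pnatr_eq0 cards_eq0.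
pose A x := \prod_(i < m) avg x i.
(* The value at the last index is chosen first, with the other factors held at their averages [A];
   it is then absorbed into the weights. *)
have [u uG Hu] : exists2 u, u \in G m &
    \sum_(x <- I) w x * f x m u * A x <= \sum_(x <- I) w x * avg x m * A x.
  apply: exists_le_average => //; rewrite exchange_big/= mulr_sumr le_eqVlt; apply/orP; left.
  apply/eqP; apply: eq_bigr => x _; rewrite -mulr_suml -mulr_sumr /avg; field.
  exact: cm.
have [v [vG Hv]] := IH (fun x => w x * f x m u) (fun i im => G0 i (ltnW im)).
exists (fun i => if i == m then u else v i); split.
  move=> i; rewrite ltnS leq_eqVlt; case: eqP => [-> //|_ /=]; exact: vG.
apply: le_trans (le_trans _ Hu) _; last first.
  by apply: ler_sum => x _; rewrite big_ord_recr/= -/(avg x m) -/(A x) mulrA (mulrAC (w x)).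
apply: le_trans Hv; apply: ler_sum => x _; rewrite big_ord_recr/= eqxx.
rewrite [X in _ * (X * _)](_ : _ = \prod_(i < m) f x i (v i)); last first.
  by apply: eq_bigr => i _; rewrite ltn_eqF.
by rewrite mulrA mulrAC.
Qed.

Lemma crt_seq (s : seq nat) (a : nat -> nat) : uniq s -> all prime s ->
  exists2 x, (x < \prod_(p <- s) p)%N & forall p, p \in s -> x = a p %[mod p].
Proof.
elim: s => [|p s IH] /=; first by exists 0%N; rewrite ?big_nil.
move=> /andP[ps us] /andP[pp sp]; have [y yl Hy] := IH us sp.
set N := \prod_(q <- s) q in yl *.
have cop : coprime p N.
  rewrite /N big_seq; apply: (big_ind (coprime p)) => [|b c cb cc|q qs].
  - by rewrite coprimen1.
  - by rewrite coprimeMr cb cc.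
  - rewrite prime_coprime// dvdn_prime2//; last exact: (allP sp).
    by apply: contraNneq ps => ->.
have N0 : (0 < N)%N by exact: leq_ltn_trans yl.
exists (chinese p N (a p) y %% (p * N))%N.
  by rewrite big_cons ltn_mod muln_gt0 prime_gt0.
move=> q; rewrite in_cons => /orP[/eqP ->|qs].
  by rewrite modn_dvdm ?dvdn_mulr// chinese_modl.
have qN : (q %| N)%N by rewrite /N (big_rem q)//= dvdn_mulr.
rewrite modn_dvdm ?dvdn_mull// -(Hy q qs).
by rewrite -(modn_dvdm _ qN) chinese_modr// modn_dvdm.
Qed.

(** * Residue vectors modulo the primes *)

Section residue_vectors.
Variables (d n : nat).
Notation V := {ffun 'I_d -> 'I_n.+1}.
Implicit Types (h : 'rV[int]_d) (v : V).

Definition residue_row v : 'rV[int]_d := \row_j (v j : nat)%:Z.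

(** A single finite type with entries up to n serves all p <= n, so that [averaging_choice] can
    treat the different moduli together. *)
Definition residues (p : nat) : {set V} := [set v : V | [forall j, (v j < p)%N]]%SET.

Definition orthogonal_mod (p : nat) h v := (p %| dotz h (residue_row v))%Z.

(** Overwriting coordinate j of a solution by any of the p residues is injective: the other
    coordinates together with h.v = 0 modulo p recover v j, because h j is invertible modulo p. *)
Lemma card_orthogonal_mod (p : nat) h : prime p -> (p <= n)%N ->
  (exists j, ~~ (p %| h ord0 j)%Z) ->
  (p * #|[set v in residues p | orthogonal_mod p h v]%SET| <= #|residues p|)%N.
Proof.
move=> pp pn [j hj]; set B := [set v in _ | _]%SET.
pose upd (x : 'I_p * V) : V := [ffun i => if i == j then inord x.1 else x.2 i].
rewrite -[X in (X * _)%N](card_ord p) -cardsT -cardsX -(@card_in_imset _ _ upd).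
  apply: subset_leq_card; apply/fintype.subsetP => _ /imsetP[[a v] + ->];
    rewrite !inE/= => /andP[vp _].
  apply/forallP => i; rewrite ffunE; case: eqP => _; last exact: (forallP vp).
  by rewrite inordK ?ltn_ord// ltnS (leq_trans (ltnW (ltn_ord a))).
move=> [a v] [b u]; rewrite !inE/= => /andP[vp vo] /andP[up uo] /ffunP E.
have ab : a = b.
  have := E j; rewrite !ffunE eqxx => /(congr1 (@nat_of_ord _)).
  by rewrite !inordK ?ltnS ?(leq_trans (ltnW (ltn_ord _)))// => /val_inj.
have vu i : i != j -> v i = u i by move=> ij; have := E i; rewrite !ffunE (negbTE ij).
suff vuj : v j = u j.
  by rewrite ab; congr pair; apply/ffunP => i; have [->|/vu] := eqVneq i j.
have : (p %| dotz h (residue_row v) - dotz h (residue_row u))%Z by exact: rpredB vo uo.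
rewrite /dotz -sumrB (bigD1 j)//= big1 ?addr0; last first.
  by move=> i ij; rewrite !mxE vu// subrr.
rewrite !mxE -mulrBr => D.
have {D} : (p %| (v j : nat)%:Z - (u j : nat)%:Z)%Z.
  by rewrite -(@Gauss_dvdzr _ (h ord0 j))// coprimezE /= prime_coprime// -dvdzE.
rewrite -eqz_mod_dvd => /eqP; rewrite !modz_nat !modn_small ?(forallP vp) ?(forallP up)//.
by case=> /val_inj.
Qed.

Lemma residues_neq0 (p : nat) : (0 < p)%N -> residues p != finset.set0.
Proof.
move=> p0; apply/finset.set0Pn; exists [ffun=> ord0]; rewrite inE.
by apply/forallP => j; rewrite ffunE.
Qed.

End residue_vectors.

Section crt_rows.
Variables (d n : nat).

(** The Chinese remainder theorem in each coordinate; h.z modulo p depends only on z modulo p. *)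
Lemma crt_row (s : seq nat) (v : nat -> {ffun 'I_d -> 'I_n.+1}) : uniq s -> all prime s ->
  exists z : 'rV[int]_d, (forall j, 0 <= z 0 j < (\prod_(p <- s) p)%N%:Z) /\
    forall p h, p \in s -> (p %| dotz h z)%Z = orthogonal_mod p h (v p).
Proof.
move=> us sp.
have /choice[x Hx] : forall j : 'I_d, exists x, (x < \prod_(p <- s) p)%N /\
    forall p, p \in s -> x = v p j %[mod p].
  by move=> j; have [x xl Hx] := crt_seq (fun p => v p j) us sp; exists x.
exists (\row_j (x j)%:Z); split.
  by move=> j; rewrite mxE le0z_nat ltz_nat; case: (Hx j).
move=> p h ps; rewrite /orthogonal_mod.
rewrite -[dotz h (residue_row _)](subrK (dotz h (\row_j (x j)%:Z))).
rewrite rpredDl// -rpredN opprB.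
rewrite /dotz -sumrB; apply: rpred_sum => j _; rewrite !mxE -mulrBr; apply: dvdz_mull.
rewrite -eqz_mod_dvd; apply/eqP; rewrite !modz_nat; congr Posz.
by case: (Hx j) => _ /(_ p ps).
Qed.

End crt_rows.

Lemma count_card (s : seq nat) (a : pred nat) :
  count a s = #|[set i : 'I_(size s) | a (nth 0%N s i)]%SET|.
Proof.
rewrite -sum1_count (big_nth 0%N) big_mkord sum1dep_card.
by apply: eq_card => i; rewrite !inE.
Qed.

Lemma geometric_sum_lt (R : realFieldType) (q : R) (m : nat) : 0 <= q -> q < 1 ->
  \sum_(1 <= k < m.+1) q ^+ k <= q / (1 - q).
Proof.
move=> q0 q1; rewrite ler_pdivlMr ?subr_gt0// mulrBr mulr1 mulr_suml.
rewrite [X in _ - X](eq_bigr (fun k => q ^+ k.+1)); last by move=> k _; rewrite exprSr.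
rewrite -sumrB (eq_bigr (fun k => - (q ^+ k.+1 - q ^+ k))); last by move=> k _; rewrite opprB.
by rewrite sumrN telescope_sumr// opprB expr1 gerBl exprn_ge0.
Qed.

(** The factorial cancels the one in the binomial coefficient binom(m, k) of the union bound. *)
Definition threshold (R : realFieldType) (k : nat) : R := k`!%:R * (4 / 3) ^+ k.

Lemma ffact_le_expn (m k : nat) : (m ^_ k <= m ^ k)%N.
Proof. by elim: k => // k IH; rewrite ffactnSr expnSr leq_mul// leq_subr. Qed.

(** * Simultaneous choice of the residues by a union bound *)

Section good_residues.
Variables (R : realFieldType) (d n : nat).
Notation V := {ffun 'I_d -> 'I_n.+1}.
Variables (s : seq nat) (L : nat -> seq 'rV[int]_d) (j0 : nat) (J : nat -> nat).
Let m := size s.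
Hypotheses (us : uniq s) (sP : forall p, p \in s -> [/\ prime p, (p <= n)%N & (n < p.*2)%N])
  (mn : (6 * m <= n)%N) (n0 : (0 < n)%N) (Lj : forall j, (size (L j) <= j)%N)
  (j0n : (8 * j0 <= n)%N)
  (JF : forall k, (J k)%:R <= threshold R k / 2).

Let prim (p : nat) (h : 'rV[int]_d) := [exists j, ~~ (p %| h ord0 j)%Z].

(* L j stands for the elements of rank at most j.  By the union bound at least 3/4
   of all residues modulo p belong to G p. *)
Let G p : {set V} := [set v in residues d n p |
  all (fun h => prim p h ==> ~~ orthogonal_mod p h v) (L j0)]%SET.

Let card_G p : p \in s -> (3 * #|residues d n p| <= 4 * #|G p|)%N.
Proof.
move=> /sP[pp pn np]; set r := #|residues d n p|.
pose B h := [set v in residues d n p | orthogonal_mod p h v]%SET.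
have H : (r <= #|G p| + \sum_(h <- L j0 | prim p h) #|B h|)%N.
  have : residues d n p \subset (G p :|: \big[@finset.setU _/finset.set0]_(h <- L j0 | prim p h) B h)%SET.
    apply/fintype.subsetP => v vr; rewrite finset.in_setU.
    case: (boolP (v \in G p)) => //=; rewrite finset.in_set vr /= => /allPn[h hL].
    rewrite negb_imply negbK => /andP[ph oh].
    by rewrite (big_rem h)//= ph finset.in_setU finset.in_set vr oh.
  move=> /subset_leq_card/leq_trans; apply; apply: leq_trans (leq_card_setU _ _) _;
    rewrite leq_add2l.
  elim/big_ind2 : _ => [|A a A' b Aa Ab|//]; first by rewrite cards0.
  exact: leq_trans (leq_card_setU _ _) (leq_add Aa Ab).
have H2 : (p * \sum_(h <- L j0 | prim p h) #|B h| <= j0 * r)%N.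
  rewrite big_distrr/=; apply: leq_trans (leq_mul (Lj j0) (leqnn r)).
  elim: (L j0) => [|h t IH] /=; first by rewrite big_nil.
  rewrite big_cons mulSn; case: ifP => [/existsP ph|_]; last exact: leq_trans IH (leq_addl _ _).
  by rewrite leq_add// card_orthogonal_mod.
have p0 := prime_gt0 pp.
rewrite -(leq_pmul2l p0) -/r.
have Hp : (p * r <= p * #|G p| + j0 * r)%N.
  by apply: leq_trans (_ : (p * (#|G p| + \sum_(h <- L j0 | prim p h) #|B h|) <= _)%N);
    rewrite ?leq_pmul2l// mulnDr leq_add2l.
(* From 8 j0 <= n < 2p: the excluded residues are at most a quarter. *)
have Hj : (4 * (j0 * r) <= p * r)%N.
  by rewrite mulnA leq_mul2r; apply/orP; right; lia.
by lia.
Qed.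

(** There are at most |residues| / p solutions, and [G p] keeps at least 3/4 of the residues: the
    ratio is at most 4/(3p), hence at most 8/(3n) because n < 2p. *)
Let avg_le p h : p \in s -> prim p h ->
  (\sum_(u in G p) ((orthogonal_mod p h u)%:R : R)) / #|G p|%:R <= 8 / (3 * n%:R).
Proof.
move=> ps ph; have [pp pn np] := sP ps; have CG := card_G ps.
have r0 : (0 < #|residues d n p|)%N by rewrite card_gt0 residues_neq0// prime_gt0.
have G0 : (0 < #|G p|)%N by lia.
have HB := card_orthogonal_mod pp pn (existsP ph).
set B := [set v in _ | _]%SET in HB.
have le1 : \sum_(u in G p) ((orthogonal_mod p h u)%:R : R) <= #|B|%:R.
  rewrite -natr_sum ler_nat -big_mkcondr/= sum1_card.
  apply: subset_leq_card; apply/fintype.subsetP => u /andP[].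
  by rewrite !finset.in_set => /andP[-> _] ->.
rewrite ler_pdivrMr ?ltr0n//; apply: (le_trans le1).
rewrite mulrAC ler_pdivlMr ?mulr_gt0 ?ltr0n//.
rewrite -!natrM ler_nat.
have : (3 * (p * #|B|) <= 4 * #|G p|)%N by rewrite (leq_trans _ CG)// leq_mul2l.
move: (#|B|) (#|G p|) => b g Hb.
have : (n * b <= p.*2 * b)%N by rewrite leq_mul2r ltnW ?orbT.
by rewrite -muln2; lia.
Qed.

Let G_neq0 p : p \in s -> G p != finset.set0.
Proof.
move=> ps; rewrite -card_gt0; have := card_G ps.
have [pp _ _] := sP ps; have : (0 <
  #|residues d n p|)%N by rewrite card_gt0 residues_neq0// prime_gt0.
by lia.
Qed.

Let pr i := nth 0%N s i.
Let pr_s i : (i < m)%N -> pr i \in s. Proof. exact: mem_nth. Qed.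
Let prim_all h := all (fun p => prim p h) s.
Let X := ((nat * 'rV[int]_d) * {set 'I_m})%type.
Let inT (T : {set 'I_m}) (i : nat) := [exists j : 'I_m, (j \in T) && (val j == i)].
Let f (x : X) (i : nat) (v : V) : R :=
  if inT x.2 i then (orthogonal_mod (pr i) x.1.2 v)%:R else 1.
(* A pair ((k, h), T) is violated when p | h.z for all p indexed by T, where
   #|T| = k and h is in L (J k); the product of the averages of f is the
   probability of this event. *)
Let tests : seq X := [seq (q, T) | q <- [seq (k, h) | k <- index_iota 1 m.+1,
  h <- [seq g <- L (J k) | prim_all g]],
   T <- enum [set T : {set 'I_m} | (#|T| == q.1)%N]%SET].

Let inTE T (i : 'I_m) : inT T i = (i \in T).
Proof.
apply/existsP/idP => [[j /andP[jT /eqP/val_inj <-]]//|iT].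
by exists i; rewrite iT eqxx.
Qed.

Let mn_le : m%:R * (8 / (3 * n%:R)) <= 4 / 9 :> R.
Proof.
rewrite mulrA ler_pdivrMr ?mulr_gt0 ?ltr0n//.
have : (6 * m)%:R <= n%:R :> R by rewrite ler_nat.
by rewrite natrM; lra.
Qed.

(** For each k, binom(m, k) (8/(3n))^k <= (4/9)^k / k! bounds the probability for one h, and at most
    k! (4/3)^k / 2 frequencies are tested. The sum of (16/27)^k / 2 over k >= 1 is 8/11. *)
Let tests_lt1 : \sum_(x <- tests) \prod_(i < m) ((\sum_(u in G (pr i)) f x i u) / #|G (pr i)|%:R) <
  1.
Proof.
set c : R := 8 / (3 * n%:R).
have c0 : 0 <= c by rewrite divr_ge0// mulr_ge0.
apply: (@le_lt_trans _ _ (\sum_(1 <= k < m.+1) 2^-1 * (16 / 27) ^+ k)); last first.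
  rewrite -mulr_sumr; apply: (@le_lt_trans _ _ (2^-1 * ((16 / 27) / (1 - 16 / 27)))).
    by rewrite ler_pM2l ?invr_gt0//; apply: geometric_sum_lt; lra.
  have -> : 1 - 16 / 27 = 11 / 27 :> R by field.
  by rewrite invf_div; lra.
rewrite /tests !big_allpairs_dep/=; apply: ler_sum => k _.
apply: (@le_trans _ _ (\sum_(h <- [seq g <- L (J k) | prim_all g]) 'C(m, k)%:R * c ^+ k)).
  rewrite big_seq [leRHS]big_seq; apply: ler_sum => h; rewrite mem_filter => /andP[/allP ph _].
  rewrite big_enum/=; apply: (@le_trans _ _ (\sum_(T in [set T : {set 'I_m} | #|T| == k]%SET) c ^+ k)).
    apply: ler_sum => T; rewrite inE => /eqP Tk.
    rewrite -Tk -prodr_const [leRHS]big_mkcond/=; apply: ler_prod => i _.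
    have pis := pr_s (ltn_ord i).
    have Gi : (0 : R) < #|G (pr i)|%:R by rewrite ltr0n card_gt0 G_neq0.
    rewrite divr_ge0 ?ler0n ?sumr_ge0//=; last by move=> u _; rewrite /f; case: ifP.
    rewrite /f /= inTE; case: ifP => iT; first exact: avg_le (ph _ pis).
    by rewrite sumr_const divff// gt_eqF.
  by rewrite sumr_const card_draws card_ord mulr_natl.
rewrite big_const_seq count_predT iter_addr_0 size_filter -[leLHS]mulr_natr.
have k0 : (0 : R) < k`!%:R by rewrite ltr0n fact_gt0.
have Hs : (count prim_all (L (J k)))%:R <= threshold R k / 2.
  by apply: le_trans (JF k); rewrite ler_nat (leq_trans (count_size _ _)).
have HC : 'C(m, k)%:R * c ^+ k <= (4 / 9) ^+ k / k`!%:R.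
  rewrite ler_pdivlMr// mulrAC -natrM bin_ffact.
  apply: (@le_trans _ _ (m%:R ^+ k * c ^+ k)).
    by rewrite ler_wpM2r ?exprn_ge0// -natrX ler_nat ffact_le_expn.
  by rewrite -exprMn lerXn2r ?nnegrE ?mulr_ge0//; lra.
apply: (@le_trans _ _ ((4 / 9) ^+ k / k`!%:R * (threshold R k / 2))).
  by apply: ler_pM => //; rewrite mulr_ge0// exprn_ge0.
rewrite /threshold [leLHS](_ : _ = 2^-1 * ((4 / 3) ^+ k * (4 / 9) ^+ k)); last by field;
  rewrite gt_eqF.
rewrite -exprMn ler_pM2l ?invr_gt0// le_eqVlt; apply/orP; left; apply/eqP.
by congr (_ ^+ _); field.
Qed.

Lemma good_residues : exists z : 'rV[int]_d,
  [/\ forall j, 0 <= z 0 j < (\prod_(p <- s) p)%N%:Z,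
     forall p h, p \in s -> h \in L j0 -> (exists j, ~~ (p %| h ord0 j)%Z) -> ~~ (p %| dotz h z)%Z &
     forall k h, (0 < k <= size s)%N -> h \in L (J k) ->
       (forall p, p \in s -> exists j, ~~ (p %| h ord0 j)%Z) ->
       (count (fun p : nat => (p %| dotz h z)%Z) s < k)%N].
Proof.
have G0 i : (i < m)%N -> G (pr i) != finset.set0 by move=> im; rewrite G_neq0// pr_s.
have [v [vG]] := averaging_choice [ffun=> ord0] tests f (fun=> 1) G0.
have E F : \sum_(x <- tests) 1 * F x = \sum_(x <- tests) F x :> R.
  by apply: eq_bigr => x _; rewrite mul1r.
rewrite !E => /le_lt_trans /(_ tests_lt1) Hv.
have sp : all prime s by apply/allP => p /sP[].
have [z [zN zo]] := crt_row (fun p => v (index p s)) us sp.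
have zoi (i : 'I_m) h : (pr i %| dotz h z)%Z = orthogonal_mod (pr i) h (v i).
  by rewrite zo ?pr_s// /pr index_uniq.
exists z; split => //.
  move=> p h ps hL /existsP ph; rewrite zo//.
  have im : (index p s < m)%N by rewrite index_mem.
  have := vG _ im; rewrite /pr nth_index// inE => /andP[_ /allP/(_ h hL)].
  by rewrite /prim ph.
move=> k h /andP[k0 km] hL hp; rewrite ltnNge; apply/negP;
  rewrite count_card => /card_geqP[t [ut tk tS]].
pose T : {set 'I_m} := [set i in t]%SET.
have Tk : #|T| = k by rewrite cardsE; have /card_uniqP -> := ut.
have xI : ((k, h), T) \in tests.
  apply/allpairsPdep; exists (k, h), T; split => //.
    apply/allpairsPdep; exists k, h; split => //; first by rewrite mem_index_iota k0.
    by rewrite mem_filter hL andbT; apply/allP => p ps; apply/existsP; exact: hp.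
  by rewrite mem_enum inE Tk.
(* If k primes divided h.z, the test given by their index set [T] would contribute 1 to a sum that
   is below 1. *)
have : 1 <= \sum_(x <- tests) \prod_(i < m) f x i (v i).
  rewrite (big_rem _ xI)/= [X in X + _]big1 ?lerDl.
    rewrite sumr_ge0// => x _; apply: prodr_ge0 => i _; rewrite /f; by case: ifP.
  move=> i _; rewrite /f /= inTE; case: ifP => //; rewrite inE => /tS.
  by rewrite inE /= -/(pr i) zoi => ->.
by rewrite leNgt Hv.
Qed.

End good_residues.
Lemma ler_powRN (R : realType) (a b c : R) : 0 < a -> a <= b -> 0 <= c -> b `^ (- c) <= a `^ (- c).
Proof.
move=> a0 ab c0; have b0 := lt_le_trans a0 ab.
rewrite !powRN lef_pV2 ?posrE ?powR_gt0//.
by apply: ge0_ler_powR => //; rewrite nnegrE ltW.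
Qed.

(** * Weights, ranks and the selected vector *)

Section weights.
Variables (R : realType) (gamma : set nat -> R) (alpha : R) (d : nat).
Hypotheses (gamma_gt0 : forall u, 0 < gamma u) (alpha_gt0 : 0 < alpha).
Implicit Types h : 'rV[int]_d.
Notation rw := (@rweight R gamma alpha d).

Lemma rweight_gt0 h : 0 < rw h.
Proof.
rewrite /rweight mulr_gt0 ?invr_gt0//; apply: prodr_gt0 => j hj.
by rewrite powR_gt0// ltr0z normr_gt0.
Qed.

Lemma eq_supp (h k : 'rV[int]_d) : (forall j, (h 0 j != 0) = (k 0 j != 0)) -> supp h = supp k.
Proof. by move=> H; rewrite /supp; congr image; apply/seteqP; split => j /=; rewrite H. Qed.

Lemma rweightN h : rw (- h) = rw h.
Proof.
rewrite /rweight (@eq_supp (- h) h); last by move=> j; rewrite mxE oppr_eq0.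
by congr (_ * _); apply: eq_big => j; rewrite mxE ?oppr_eq0// normrN.
Qed.

Lemma row_neq0P h : h != 0 -> exists j, h 0 j != 0.
Proof.
move=> h0; apply/existsP; apply: contraNT h0 => /existsPn H.
by apply/eqP/rowP => j; rewrite mxE; apply/eqP; have := H j; rewrite negbK.
Qed.

(** Every nonzero coordinate gains a factor p^alpha; one such factor is kept and the others are
    bounded below by 1. *)
Lemma rweight_scale (p : nat) h : (0 < p)%N -> h != 0 -> p%:R `^ alpha * rw h <= rw (p%:Z *: h).
Proof.
move=> p0 /row_neq0P[j hj]; have pz : (p%:Z != 0) by rewrite -lt0n in p0 *; lia.
rewrite /rweight (@eq_supp (p%:Z *: h) h); last by move=> i; rewrite mxE mulf_eq0 negb_or pz.
rewrite mulrCA ler_pM2l ?invr_gt0//.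
rewrite [leRHS](eq_big (fun i => h 0 i != 0) (fun i => p%:R `^ alpha * `|h 0 i|%:~R `^ alpha));
  first last.
- by move=> i _; rewrite mxE normrM intrM powRM ?ler0z//.
- by move=> i; rewrite mxE mulf_eq0 negb_or pz.
rewrite big_split/= ler_wpM2r//; first by rewrite prodr_ge0// => i _; exact: powR_ge0.
rewrite (bigD1 j)//= ler_peMr ?powR_ge0//.
elim/big_rec : _ => // i x _ x1; rewrite mulr_ege1//.
by rewrite -[leLHS](powRr0 p%:R) ler_powR ?ler1n// ltW.
Qed.

Lemma low0_false (Q : pred 'rV[int]_d) h : Q h -> ~ low Q rw 0 h.
Proof.
move=> Qh [_ /(_ [:: h])] /=; rewrite Qh => /(_ isT isT); rewrite ltnn => H.
by have : false by apply: H => y; rewrite inE => /eqP ->.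
Qed.

(* Selects one element of each pair {h, -h}, which gains a factor 2 in the
   comparison of the rank with mu. *)
Definition half h := (pickle h < pickle (- h))%N.

Lemma halfN h : h != 0 -> half h || half (- h).
Proof.
move=> h0; rewrite /half opprK -neq_ltn; apply: contra h0 => /eqP /(pcan_inj pickleK) E.
apply/eqP/rowP => j; have := congr1 (fun k : 'rV[int]_d => k 0 j) E; rewrite !mxE.
by move/eqP; rewrite -addr_eq0 -mulr2n mulrn_eq0 => /eqP.
Qed.

(** There are j + 1 elements of weight at most r(h); with their negatives they give 2 (j + 1)
    distinct terms of mu, each at least r(h)^(-1/lambda). *)
Lemma mu_sum_not_low (lambda M : R) (j : nat) h : 0 < lambda ->
  (mu_sum gamma alpha d lambda <= M%:E)%E -> half h -> ~ low half rw j h ->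
  2 * j.+1%:R <= M * rw h `^ lambda^-1.
Proof.
move=> l0 muM hh /(not_low hh)[t [ut ht wt st]].
have rwl : 0 < rw h `^ lambda^-1 by rewrite powR_gt0// rweight_gt0.
rewrite -ler_pdivrMr// -powRN -lee_fin; apply: le_trans muM.
pose t' := t ++ map -%R t.
have ut' : uniq t'.
  rewrite cat_uniq ut (map_inj_uniq (@oppr_inj _)) ut andbT /=.
  apply/hasPn => _ /mapP[y /(allP ht) hy ->]; apply/negP => /(allP ht).
  by rewrite /half opprK ltnNge ltnW.
have ht' y : y \in t' -> y != 0 /\ rw y <= rw h.
  rewrite mem_cat => /orP[yt|/mapP[x xt ->]].
    split; last exact: wt.
    by apply/eqP => y0; have := allP ht _ yt; rewrite y0 /half oppr0 ltnn.
  rewrite rweightN; split; last exact: wt.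
  by apply/eqP => y0; have := allP ht _ xt; rewrite -[x]opprK y0 /half !oppr0 ltnn.
rewrite /mu_sum; apply: esum_ge; exists [set` t'].
  by split; [exact: finite_seq|move=> y /= /ht'[]].
rewrite -fsbig_seq// sumEFin lee_fin.
apply: (@le_trans _ _ (\sum_(y <- t') rw h `^ (- lambda^-1))).
  rewrite big_const_seq count_predT iter_addr_0 size_cat size_map st addnn -mul2n.
  by rewrite -[leRHS]mulr_natl natrM.
have Ht y : y \in t' -> rw h `^ (- lambda^-1) <= rw y `^ (- lambda^-1).
  by move=> /ht'[_ yh]; apply: ler_powRN => //; [exact: rweight_gt0|by rewrite invr_ge0 ltW].
move: Ht; move: (rw h) => c; move: (fun y => rw y) => F Ht.
rewrite big_seq [leRHS]big_seq; apply: ler_sum => y yt; exact: Ht.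
Qed.

Lemma dotzN h z : dotz (- h) z = - dotz h z.
Proof. by rewrite /dotz -sumrN; apply: eq_bigr => j _; rewrite mxE mulNr. Qed.

Lemma dotzZ (a : int) h z : dotz (a *: h) z = a * dotz h z.
Proof. by rewrite /dotz mulr_sumr; apply: eq_bigr => j _; rewrite mxE mulrA. Qed.

Lemma threshold_gt0 k : 0 < threshold R k.
Proof. by rewrite mulr_gt0 ?ltr0n ?fact_gt0// exprn_gt0//; lra. Qed.

Lemma threshold_ge1 k : 1 <= threshold R k.
Proof. by rewrite mulr_ege1 ?ler1n ?fact_gt0// exprn_ege1//; lra. Qed.

Lemma thresholdS k : threshold R k.+1 = (4 / 3 * k.+1%:R) * threshold R k.
Proof. by rewrite /threshold factS natrM exprS; ring. Qed.

Lemma threshold_le j k : (j <= k)%N -> threshold R j <= threshold R k.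
Proof.
elim: k => [|k IH]; first by rewrite leqn0 => /eqP ->.
rewrite leq_eqVlt => /orP[/eqP ->//|]; rewrite ltnS => /IH /le_trans; apply.
rewrite thresholdS ler_peMl ?ltW ?threshold_gt0//.
have : (1 : R) <= k.+1%:R by rewrite ler1n.
lra.
Qed.

Section selected_vector.
Variable n : nat.
Let s := primes_upper_half n.
Hypotheses (n34 : (34 < n)%N) (mn : (6 * size s <= n)%N).

Let sP p : p \in s -> [/\ prime p, (p <= n)%N & (n < p.*2)%N].
Proof. by rewrite mem_filter mem_index_iota ltnS => /andP[/andP[-> ->]] /= ->. Qed.

(** The lists [L] come from the order by r alone, so lambda and M are introduced after z. An
    induction on the sum of the |h_j| then descends from the multiples of a prime to h / p. *)
Lemma good_vector : exists z : 'rV[int]_d,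
  (forall j, 0 <= z 0 j < (\prod_(p <- s) p)%N%:Z) /\
  forall (lambda M : R), 0 < lambda -> lambda < alpha ->
   (mu_sum gamma alpha d lambda <= M%:E)%E -> forall h, h != 0 ->
   let k := count (fun p : nat => (p %| dotz h z)%Z) s in
   threshold R k <= M * rw h `^ lambda^-1 /\
   ((0 < k)%N -> n%:R / 4 <= M * rw h `^ lambda^-1).
Proof.
have lin1 (a b p : nat) : (a <= b)%N -> (6 * b <= n)%N -> (n < p.*2)%N -> (8 * a.+1 <= 6 * p)%N.
  by lia.
have lin2 (a b : R) : 8 * a <= 6 * b -> 4 / 3 * a <= b by lra.
have lin3 (a b c : R) : 0 <= a -> a <= 2 * b -> b <= c -> a / 4 <= c by lra.
have /choice[L HL] := low_enum half rw.
(* The largest j0 with 8 j0 < n. Since 8 (j0 + 1) >= n, an h that is not low for j0 has M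
   r(h)^(1/lambda) >= 2 (j0 + 1) >= n/4. *)
pose j0 := (n.-1 %/ 8)%N.
(* Rounding down keeps the list within half the threshold, while 2 (J k + 1) exceeds the threshold,
   as needed for the h outside the list. *)
pose J k := Num.trunc (threshold R k / 2).
have JP k : (J k)%:R <= threshold R k / 2 < (J k).+1%:R.
  by apply: truncn_itv; rewrite divr_ge0// ltW// threshold_gt0.
have [z [zN za zb]] := @good_residues R d n s L j0 J (primes_upper_half_uniq n) sP mn
  (ltnW (leq_trans (isT : 1 < 35)%N n34)) (fun j => let: And3 _ h _ := HL j in h)
  (ltac:(rewrite /j0; lia)) (fun k => proj1 (andP (JP k))).
exists z; split => // lambda M l0 la muM.
pose ok h := let k := count (fun p : nat => (p %| dotz h z)%Z) s in
   threshold R k <= M * rw h `^ lambda^-1 /\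
   ((0 < k)%N -> n%:R / 4 <= M * rw h `^ lambda^-1).
have half_ok h : half h -> (forall p, p \in s -> exists j, ~~ (p %| h ord0 j)%Z) -> ok h.
  move=> hh hp; rewrite /ok /=; set k := count _ s.
  have km : (k <= size s)%N by exact: count_size.
  split.
    (* For k = 0 the threshold is 1, and the pair h, -h alone gives the bound 2. *)
    have [->|k0] := posnP k.
      have := mu_sum_not_low l0 muM hh (low0_false hh).
      by rewrite /threshold fact0 expr0; lra.
    have nl : ~ low half rw (J k) h.
      move=> lh; have [_ _ /(_ _ lh) hL] := HL (J k).
      have := zb k h; rewrite k0 km => /(_ isT hL hp); by rewrite ltnn.
    have := mu_sum_not_low l0 muM hh nl; have /andP[_] := JP k.
    by move: ((J k).+1%:R : R) (threshold R k) (M * _) => a b c; lra.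
  rewrite -has_count => /hasP[p ps pz].
  have nl : ~ low half rw j0 h.
    move=> lh; have [_ _ /(_ _ lh) hL] := HL j0.
    by have := za p h ps hL (hp p ps); rewrite pz.
  have := mu_sum_not_low l0 muM hh nl.
  have : (n%:R : R) <= (8 * j0.+1)%:R by rewrite ler_nat /j0; lia.
  by rewrite natrM; lra.
have okN h : ok (- h) -> ok h.
  by rewrite /ok rweightN; under eq_count => p do rewrite dotzN rpredN.
suff main N : forall h, (\sum_j `|h ord0 j|%N <= N)%N -> h != 0 -> ok h.
  by move=> h h0; exact: (main _ h (leqnn _) h0).
elim: N => [|N IH] h hN h0.
  have [j hj] := row_neq0P h0; move: hN; rewrite leqn0 sum_nat_eq0.
  by move=> /forallP/(_ j); rewrite /= absz_eq0 (negbTE hj).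
have [/allP cop|] := boolP (all (fun p : nat => [exists j, ~~ (p %| h ord0 j)%Z]) s).
  have hp p : p \in s -> exists j, ~~ (p %| h ord0 j)%Z by move=> /cop/existsP.
  have [hh|hh] := orP (halfN h0); first exact: half_ok.
  apply: okN; apply: half_ok => // p /hp[j hj]; exists j.
  by rewrite mxE rpredN.
move=> /allPn[p ps]; rewrite negb_exists => /forallP ph.
have [pp pn np] := sP ps; have p0 := prime_gt0 pp.
have [h' hE] : exists h' : 'rV[int]_d, h = p%:Z *: h'.
  exists (\row_j (h ord0 j %/ p)%Z); apply/rowP => j; rewrite !mxE mulrC divzK//.
  by have := ph j; rewrite negbK.
have h'0 : h' != 0 by apply: contraNneq h0 => h'0; rewrite hE h'0 scaler0.
have h'N : (\sum_j `|h' ord0 j|%N <= N)%N.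
  have [j hj] := row_neq0P h'0; rewrite -ltnS; apply: leq_trans hN.
  rewrite [ltnRHS](bigD1 j)//= [ltnLHS](bigD1 j)//= -addSn leq_add//.
    by rewrite hE mxE abszM /= ltn_Pmull ?prime_gt1// absz_gt0.
  by apply: leq_sum => i _; rewrite hE mxE abszM/= leq_pmull.
have [] := IH h' h'N h'0; set k' := count _ s => Hk' _.
(* Here lambda < alpha enters: p^(alpha/lambda) >= p. *)
have rwp : p%:R * (M * rw h' `^ lambda^-1) <= M * rw h `^ lambda^-1.
  have M0 : 0 <= M.
    by rewrite -lee_fin; apply: le_trans muM; apply: esum_ge0 => *; rewrite lee_fin powR_ge0.
  rewrite mulrCA ler_wpM2l//.
  have := rweight_scale p0 h'0; rewrite -hE => Hs.
  apply: (@le_trans _ _ ((p%:R `^ alpha * rw h') `^ lambda^-1)); last first.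
    have r1 : 0 < rw h by exact: rweight_gt0.
    have r2 : 0 < rw h' by exact: rweight_gt0.
    apply: ge0_ler_powR => //; [by rewrite invr_ge0 ltW| |by rewrite nnegrE ltW].
    by rewrite nnegrE mulr_ge0 ?powR_ge0// ltW.
  have r2 : 0 < rw h' by exact: rweight_gt0.
  rewrite powRM ?powR_ge0 ?(ltW r2)// ler_pM2r ?powR_gt0//.
  rewrite -powRrM -[leLHS]powRr1// ler_powR ?ler1n// -ler_pdivrMr ?invr_gt0//.
  by rewrite invrK mul1r ltW.
(* Since h.z = p (h'.z), only p itself can divide h.z without dividing h'.z. *)
have kk : (count (fun q : nat => (q %| dotz h z)%Z) s <= k'.+1)%N.
  have -> : k'.+1 = size (p :: [seq q : nat <- s | ((q : nat)%:Z %| dotz h' z)%Z]).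
    by rewrite /= size_filter.
  rewrite -size_filter.
  apply: uniq_leq_size; first by rewrite filter_uniq// primes_upper_half_uniq.
  move=> q; rewrite in_cons !(mem_filter _ q s) => /andP[+ qs];
    rewrite qs andbT hE dotzZ dvdzE abszM /=.
  by case: (sP qs) => pq _ _; rewrite Euclid_dvdM// dvdn_prime2.
(* From 6 k' <= 6 |P_n| <= n < 2p one gets 4/3 (k' + 1) <= p, so one more prime costs no more than
   the factor p gained. *)
have Fk : threshold R k'.+1 <= p%:R * threshold R k'.
  rewrite thresholdS; apply: ler_wpM2r; first exact/ltW/threshold_gt0.
  have k's : (k' <= size s)%N by exact: count_size.
  by apply: lin2; rewrite -!natrM ler_nat; exact: lin1 mn np.
have Fp : p%:R * threshold R k' <= M * rw h `^ lambda^-1.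
  by apply: le_trans rwp; rewrite ler_wpM2l.
split; first by apply: le_trans Fp; apply: le_trans Fk; exact: threshold_le.
(* The factor p > n/2 and a threshold of at least 1 already exceed n/4. *)
move=> _; apply: le_trans Fp.
have p2 : (n%:R : R) <= (2 * p)%:R by rewrite ler_nat mul2n ltnW.
apply: (lin3 _ p%:R) => //; first by rewrite -natrM.
by rewrite ler_peMr// threshold_ge1.
Qed.

End selected_vector.
End weights.

(** * The error bound *)

Section moment_bound.
Variable R : realType.

Lemma expn_le_fact_expR (x : R) (k : nat) : 0 <= x -> x ^+ k <= k`!%:R * expR x.
Proof.
case: k => [|k] x0; first by rewrite expr0 fact0 mul1r -expR0 ler_expR.
rewrite mulrC -ler_pdivrMr ?ltr0n ?fact_gt0//.
by apply: le_trans (expR_ge1Dxn k x0); rewrite lerDr.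
Qed.

(* Exponential moment: k <= (r / (e s)) e^(s k / r) with e^s = r + 1, and
   (r + 1)^k <= k! (4/3)^k e^(3 (r + 1) / 4). *)
Lemma expn_le_threshold (r k : nat) : (0 < r)%N ->
  k%:R ^+ r <= 4 * ((792 / 1000) * r%:R / ln (r%:R + 1)) ^+ r * threshold R k.
Proof.
move=> r0; set s : R := ln (r%:R + 1).
have rR : (0 : R) < r%:R by rewrite ltr0n.
have s0 : 0 < s by rewrite ln_gt0//; lra.
have es : expR s = r%:R + 1 by rewrite lnK// posrE; lra.
(* e^(1/8) >= 9/8 gives e^(1/4) >= 81/64, and 64/81 < 0.792. *)
have e14 : expR (- 4^-1) <= 792 / 1000 :> R.
  have h : 9 / 8 <= expR (8^-1 : R) by apply: le_trans (expR_ge1Dx _); lra.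
  have h2 : 81 / 64 <= expR (4^-1 : R).
    rewrite (_ : 4^-1 = 8^-1 * 2%:R :> R); last by field.
    by rewrite expRM_natr expr2; nra.
  have E : expR (- 4^-1) * expR 4^-1 = 1 :> R by rewrite -expRD addNr expR0.
  have e0 : 0 <= expR (- 4^-1 : R) by exact: expR_ge0.
  have := ler_wpM2l e0 h2; rewrite E; move: (expR _) => e; lra.
(* e^(-1/4) >= 3/4 gives e^(-3/4) >= 27/64 > 1/4. *)
have e34 : expR (3 / 4) <= 4 :> R.
  have h : 3 / 4 <= expR (- 4^-1 : R) by apply: le_trans (expR_ge1Dx _); lra.
  have h2 : 4^-1 <= expR (- (3 / 4)) :> R.
    rewrite (_ : - (3 / 4) = (- 4^-1) * 3%:R :> R); last by field.
    rewrite expRM_natr !exprS expr0 mulr1.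
    move: h; move: (expR _) => e h.
    have : (3 / 4) * (3 / 4) <= e * e by apply: ler_pM; lra.
    by nra.
  have E : expR (3 / 4) * expR (- (3 / 4)) = 1 :> R by rewrite -expRD subrr expR0.
  have e0 : 0 <= expR (3 / 4 : R) by exact: expR_ge0.
  have := ler_wpM2l e0 h2; rewrite E; move: (expR _) => e; lra.
have step1 : s * k%:R / r%:R <= expR (s * k%:R / r%:R - 1).
  by apply: le_trans (expR_ge1Dx _); lra.
have step2 : k%:R ^+ r <= (r%:R / s) ^+ r * expR (s * k%:R - r%:R).
  have -> : expR (s * k%:R - r%:R) = expR (s * k%:R / r%:R - 1) ^+ r.
    rewrite -expRM_natr; congr expR; field; lra.
  have p0 : 0 <= r%:R / s * expR (s * k%:R / r%:R - 1).
    by rewrite mulr_ge0 ?expR_ge0// ltW// divr_gt0.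
  rewrite -exprMn lerXn2r ?nnegrE//.
  rewrite -ler_pdivrMl ?divr_gt0// invf_div mulrAC; exact: step1.
have step3 : expR (s * k%:R) <= threshold R k * expR (3 / 4 * (r%:R + 1)).
  rewrite expRM_natr es /threshold.
  have x0 : 0 <= 3 / 4 * (r%:R + 1) :> R by lra.
  have := expn_le_fact_expR k x0; rewrite exprMn => H.
  have E2 : (4 / 3) ^+ k * (3 / 4) ^+ k = 1 :> R.
    by rewrite -exprMn (_ : 4 / 3 * (3 / 4) = 1 :> R) ?expr1n//; field.
  set E := expR _ in H *; set x := _ + 1 in H *.
  rewrite [leRHS](_ : _ = (4 / 3) ^+ k * (k`!%:R * E)); last by ring.
  rewrite [leLHS](_ : _ = (4 / 3) ^+ k * ((3 / 4) ^+ k * x ^+ k)); last by rewrite mulrA E2 mul1r.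
  by rewrite ler_wpM2l// exprn_ge0//; lra.
apply: (le_trans step2).
apply: (@le_trans _ _ ((r%:R / s) ^+ r * ((expR (- 4^-1)) ^+ r * 4 * threshold R k))).
  rewrite ler_pM2l ?exprn_gt0 ?divr_gt0// expRD.
  apply: (@le_trans _ _ (threshold R k * expR (3 / 4 * (r%:R + 1)) * expR (- r%:R))).
    by rewrite ler_pM2r ?expR_gt0.
  rewrite -mulrA mulrC ler_wpM2r//.
    by rewrite mulr_ge0 ?ler0n ?exprn_ge0//; lra.
  (* Since 3(r + 1)/4 - r = -r/4 + 3/4, each of the r factors receives e^(-1/4), and the constant
     e^(3/4) goes into the 4. *)
  rewrite -expRD (_ : _ + _ = - 4^-1 * r%:R + 3 / 4); last by field.
  by rewrite expRD expRM_natr ler_pM2l ?exprn_gt0 ?expR_gt0.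
set q : R := r%:R / s; have q0 : 0 < q by rewrite divr_gt0.
have e0 : 0 <= expR (- 4^-1) :> R by exact: expR_ge0.
have eE : expR (- 4^-1) ^+ r <= (792 / 1000) ^+ r :> R.
  by apply: lerXn2r => //; rewrite nnegrE; lra.
have F0 : 0 <= threshold R k by rewrite mulr_ge0 ?ler0n ?exprn_ge0//; lra.
rewrite [leRHS](_ : _ = q ^+ r * ((792 / 1000) ^+ r * 4 * threshold R k)); last first.
  have -> : 792 / 1000 * r%:R / s = 792 / 1000 * q by rewrite /q; ring.
  by rewrite [(_ * q) ^+ r]exprMn; ring.
by rewrite ler_wpM2l ?exprn_ge0 ?(ltW q0)// !ler_wpM2r.
Qed.

End moment_bound.

(** * Convergence of the zeta series *)

Section zeta.
Variable R : realType.

(** Discrete form of the comparison with an integral: write (k/(k+1))^(-t) as an exponential and use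
    e^y >= 1 + y and ln(1 - 1/(k+1)) <= -1/(k+1). *)
Lemma powRN_telescope (t : R) (k : nat) : 0 < t -> (0 < k)%N ->
  t * k.+1%:R `^ (- (t + 1)) <= k%:R `^ (- t) - k.+1%:R `^ (- t).
Proof.
move=> t0 k0; have kR : (0 : R) < k%:R by rewrite ltr0n.
have k1 : (0 : R) < k.+1%:R by rewrite ltr0n.
have -> : k.+1%:R `^ (- (t + 1)) = k.+1%:R `^ (- t) / k.+1%:R.
  rewrite !powRN powRD ?powRr1 ?invfM ?(ltW k1)//.
  by apply/implyP => _; rewrite gt_eqF.
have -> : k%:R `^ (- t) = k.+1%:R `^ (- t) * expR (t * - ln (k%:R / k.+1%:R)).
  rewrite /powR !gt_eqF// -expRD; congr expR; rewrite lnM ?posrE ?invr_gt0// lnV ?posrE//; ring.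
rewrite -[X in _ <= _ - X]mulr1 -mulrBr mulrCA ler_wpM2l ?powR_ge0//.
rewrite lerBrDr; apply: le_trans (expR_ge1Dx _); rewrite addrC lerD2l ler_pM2l// lerNr.
have -> : k%:R / k.+1%:R = 1 + - k.+1%:R^-1 :> R.
  by rewrite -natr1; field; rewrite natr1 gt_eqF.
by apply: le_ln1Dx; rewrite ltrNl opprK invf_lt1// ltr1n.
Qed.

(** The [limn] in [zeta] is a genuine limit once the partial sums are bounded; telescoping bounds
    them by 1 + 1/(s - 1). *)
Lemma zeta_ge (s : R) (n : nat) : 1 < s -> \sum_(1 <= k < n) k%:R `^ (- s) <= zeta s.
Proof.
move=> s1; pose u n : R := \sum_(1 <= k < n) k%:R `^ (- s).
have nd : {homo u : n m / (n <= m)%N >-> n <= m}.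
  apply/nondecreasing_seqP => m; rewrite /u; case: m => [|m].
    by rewrite !big_geq.
  by rewrite [leRHS]big_nat_recr//= lerDl powR_ge0.
apply: (nondecreasing_cvgn_le nd); apply: nondecreasing_is_cvgn => //.
pose t := s - 1; have t0 : 0 < t by rewrite subr_gt0.
have ub m : u m.+2 <= 1 + (1 - m.+1%:R `^ (- t)) / t.
  elim: m => [|m IH]; first by rewrite /u big_nat1 !powR1 subrr mul0r addr0.
  rewrite /u big_nat_recr//= -/(u m.+2).
  have := powRN_telescope t0 (ltn0Sn m); rewrite (_ : t + 1 = s); last by rewrite /t; ring.
  rewrite mulrC -ler_pdivlMr// => H; apply: le_trans (lerD IH H) _.
  by rewrite -addrA -mulrDl addrA subrK.
exists (1 + t^-1) => _ [m _ <-]; case: m => [|[|m]].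
- by rewrite /u big_geq// addr_ge0// invr_ge0 ltW.
- by rewrite /u big_geq// addr_ge0// invr_ge0 ltW.
apply: le_trans (ub m) _; rewrite lerD2l ler_pdivrMr// mulVf ?gt_eqF// gerBl.
Qed.

End zeta.

(** * Comparison of mu with the dimension-free weight sum *)

Section mu_sum_weight_sum.
Variables (R : realType) (gamma : set nat -> R) (alpha : R) (d : nat).
Hypotheses (gamma_gt0 : forall u, 0 < gamma u).
Implicit Types h : 'rV[int]_d.

Let S h : {set 'I_d} := [set j | h ord0 j != 0]%SET.
(** Supports within the d coordinates, seen as the finite sets of naturals over which [weight_sum]
    runs. *)
Let U (A : {set 'I_d}) : set nat := [set` [seq val j | j <- enum A]].

Let suppE h : supp h = U (S h).
Proof.
apply/seteqP; split => i /=.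
  by move=> [j /= hj <-]; apply: map_f; rewrite mem_enum inE.
by move=> /mapP[j]; rewrite mem_enum inE => hj ->; exists j.
Qed.

Let card_U A : size (finmap.enum_fset (fset_set (U A))) = #|A|.
Proof.
have uA : uniq [seq val j | j <- enum A] by rewrite (map_inj_uniq val_inj) enum_uniq.
have : \big[addn/0%N]_(i \in U A) 1%N = #|A|.
  by rewrite -fsbig_seq// big_const_seq count_predT iter_addn_0 mul1n size_map -cardE.
rewrite fsbig_finite//=; last exact: finite_seq.
by rewrite big_const_seq count_predT iter_addn_0 mul1n.
Qed.

Let memU A (j : 'I_d) : U A (val j) <-> j \in A.
Proof.
have -> : U A (val j) = (val j \in [seq val i | i <- enum A]) by [].
by rewrite (mem_map val_inj) mem_enum.
Qed.

Let U_inj : injective U.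
Proof.
move=> A B AB; apply/setP => j.
by apply/idP/idP => /memU; [rewrite AB|rewrite -AB] => /memU.
Qed.

(** Expanding the power of twice a partial zeta sum gives one term for each choice of signs and
    absolute values on A, and [phi] sends distinct h to distinct terms. *)
Lemma sum_support_le (s : R) (A : {set 'I_d}) (t : seq 'rV[int]_d) : 1 < s -> uniq t ->
  (forall h, h \in t -> S h = A) ->
  \sum_(h <- t) \prod_(j in A) `|h ord0 j|%:~R `^ (- s) <= (2 * zeta s) ^+ #|A|.
Proof.
move=> s1 ut tA.
pose N := \max_(h <- t) \max_(j < d) `|h ord0 j|%N.
have tN h j : h \in t -> (`|h ord0 j| <= N)%N.
  move=> ht; apply: (@leq_trans (\max_(j < d) `|h ord0 j|%N)); last exact: leq_bigmax_seq.
  exact: (leq_bigmax j).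
(* A pair encodes the sign and |h_j| - 1; [y0] fills the coordinates outside A. *)
pose T := (bool * 'I_N.+1)%type; pose y0 : T := (false, ord0).
pose c (x : T) : R := x.2.+1%:R `^ (- s).
have cS : \sum_(x : T) c x <= 2 * zeta s.
  rewrite -(pair_big xpredT xpredT (fun (_ : bool) (i : 'I_N.+1) => i.+1%:R `^ (- s)))/=.
  have : \sum_(i < N.+1) i.+1%:R `^ (- s) <= zeta s.
    by apply: le_trans (zeta_ge N.+2 s1); rewrite big_add1 /= big_mkord.
  by rewrite big_bool /=; lra.
apply: (@le_trans _ _ ((\sum_(x : T) c x) ^+ #|A|)); last first.
  apply: lerXn2r => //; rewrite nnegrE.
    by apply: sumr_ge0 => x _; exact: powR_ge0.
  by apply: le_trans cS; apply: sumr_ge0 => x _; exact: powR_ge0.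
rewrite -prodr_const (big_distr_big y0 (mem A) xpredT (fun _ x => c x))/=.
pose phi h : {ffun 'I_d -> T} :=
  [ffun j => if j \in A then (h ord0 j < 0, inord (`|h ord0 j|.-1)) else y0].
have hA h j : h \in t -> (h ord0 j != 0) = (j \in A) by move=> /tA <-; rewrite inE.
have phiE h j : h \in t -> j \in A -> (phi h j).2.+1 = `|h ord0 j|%N.
  move=> ht jA; rewrite ffunE jA /= inordK.
    by rewrite prednK// absz_gt0 hA.
  by rewrite ltnS (leq_trans (leq_pred _))// tN.
have phi_inj : {in t &, injective phi}.
  move=> h k ht kt E; apply/rowP => j; have [jA|jA] := boolP (j \in A).
    have E2 : `|h ord0 j|%N = `|k ord0 j|%N by rewrite -!phiE// E.
    have E1 : (h ord0 j < 0) = (k ord0 j < 0).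
      by have := congr1 (fun f : {ffun 'I_d -> T} => (f j).1) E; rewrite !ffunE jA.
    by move: E1 E2; move: (h ord0 j) (k ord0 j) => a b; lia.
  by have := hA h j ht; have := hA k j kt; rewrite (negbTE jA) => /negbFE/eqP -> /negbFE/eqP ->.
rewrite big_seq (eq_bigr (fun h => \prod_(j in A) c (phi h j))); last first.
  by move=> h ht; apply: eq_bigr => j jA; rewrite /c phiE// -pmulrn abszE.
rewrite -big_seq -(big_map phi xpredT (fun f => \prod_(j in A) c (f j))).
rewrite big_uniq/=; last by rewrite map_inj_in_uniq.
rewrite [leRHS]big_mkcond [leLHS]big_mkcond/=; apply: ler_sum => f _.
case: ifP => fm; last by case: ifP => // _; apply: prodr_ge0 => j _; exact: powR_ge0.
rewrite ifT//; move: fm => /mapP[h ht ->].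
apply/pffun_onP; split => //; apply/fintype.subsetP => j; rewrite inE /= ffunE.
by apply: contraNT => /negbTE ->.
Qed.

(** The frequencies are grouped by support, and each nonempty support A accounts for the single term
    of A in the weight sum. *)
Lemma mu_sum_le_weight_sum (lambda : R) : 0 < lambda -> lambda < alpha ->
  (mu_sum gamma alpha d lambda <= weight_sum gamma alpha lambda)%E.
Proof.
move=> l0 la; set s := alpha / lambda.
have s1 : 1 < s by rewrite ltr_pdivlMr// mul1r.
have z0 : 0 <= zeta s.
  by apply: le_trans (zeta_ge 1 s1); rewrite big_geq.
pose W (A : {set 'I_d}) := gamma (U A) `^ lambda^-1 * (2 * zeta s) ^+ #|A|.
apply: ub_ereal_sup => _ [X [finX X0] <-].
apply: (@le_trans _ _ (\sum_(A | A != finset.set0) W A)%:E).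
  rewrite fsbig_finite//; set t := finmap.enum_fset _.
  have ut : uniq t by exact: finmap.fset_uniq.
  have t0 h : h \in t -> h != 0 by rewrite in_fset_set// inE => /X0.
  rewrite sumEFin lee_fin.
  have E h : rweight gamma alpha h `^ (- lambda^-1) =
     gamma (U (S h)) `^ lambda^-1 * \prod_(j in S h) `|h ord0 j|%:~R `^ (- s).
    have g0 := gamma_gt0 (supp h).
    have p0 : 0 <= \prod_(j < d | h 0 j != 0) (`|h 0 j|%:~R : R) `^ alpha.
      by apply: prodr_ge0 => j _; exact: powR_ge0.
    rewrite /rweight powRM ?invr_ge0 ?(ltW g0)// -suppE; congr (_ * _).
      by rewrite -powR_inv1 ?(ltW g0)// -powRrM mulrNN mul1r.
    rewrite [RHS](eq_bigl (fun j => h 0 j != 0)); last by move=> j; rewrite inE.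
    suff [] : 0 <= \prod_(j < d | h 0 j != 0) (`|h 0 j|%:~R : R) `^ alpha /\
      (\prod_(j < d | h 0 j != 0) (`|h 0 j|%:~R : R) `^ alpha) `^ (- lambda^-1) =
      \prod_(j < d | h 0 j != 0) (`|h 0 j|%:~R : R) `^ (- s) by [].
    elim/big_ind2 : _ => [|x1 x2 y1 y2 [p1 e1] [p2 e2]|j _]; first by rewrite powR1.
      by rewrite mulr_ge0// powRM// e1 e2.
    by rewrite powR_ge0 -powRrM mulrN.
  rewrite (eq_bigr _ (fun h _ => E h)) big_seq.
  rewrite (partition_big S (fun A => A != finset.set0))/=; last first.
    move=> h /t0/row_neq0P[j hj]; apply/finset.set0Pn; exists j; by rewrite inE.
  apply: ler_sum => A _; rewrite /W.
  rewrite (eq_bigr (fun h => gamma (U A) `^ lambda^-1 * \prod_(j in A) `|h ord0 j|%:~R `^ (- s)));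
    last first.
    by move=> h /andP[_ /eqP ->].
  rewrite -mulr_sumr ler_wpM2l ?powR_ge0// -big_seq_cond -big_filter.
  apply: sum_support_le => //; first exact: filter_uniq.
  by move=> h; rewrite mem_filter => /andP[/eqP].
rewrite /weight_sum; apply: esum_ge.
exists [set` [seq U A | A <- enum [pred A : {set 'I_d} | A != finset.set0]]].
  split; first exact: finite_seq.
  move=> u /= /mapP[A]; rewrite mem_enum inE => /finset.set0Pn[j jA] ->; split.
    exact: finite_seq.
  by exists (val j); apply: map_f; rewrite mem_enum.
rewrite -fsbig_seq; last by rewrite (map_inj_uniq U_inj) enum_uniq.
rewrite big_map big_enum/= sumEFin lee_fin; apply: ler_sum => A _.
by rewrite /W card_U.
Qed.

End mu_sum_weight_sum.

(** * From the counting bounds to the error bound *)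

Section final_bound.
Variables (R : realType) (gamma : set nat -> R) (alpha : R) (d n : nat).
Hypotheses (gamma_gt0 : forall u, 0 < gamma u).
Variables (z : 'rV[int]_d) (C1 C3 lambda M : R) (r : nat).
Let s := primes_upper_half n.
Let k (h : 'rV[int]_d) := count (fun p : nat => (p %| dotz h z)%Z) s.
Let rho (h : 'rV[int]_d) := rweight gamma alpha h `^ lambda^-1.
Hypotheses (C3E : C3 = 792 / 1000) (n34 : (34 < n)%N) (C10 : 0 < C1) (C1s : C1 * (n%:R / ln n%:R) <=
  (size s)%:R)
  (l0 : 0 < lambda) (r0 : (0 < r)%N) (lr : 1 / (2 * lambda) <= r%:R) (M0 : 0 <= M).
Hypothesis zP : forall h, h != 0 -> threshold R (k h) <= M * rho h /\
  ((0 < k h)%N -> n%:R / 4 <= M * rho h).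

Let Q : R := C3 * r%:R / ln (r%:R + 1).
Let B : R := 1 / n%:R `^ (lambda + (r%:R - 1) / (2 * r%:R))
  * (C3 * r%:R * ln n%:R / (C1 * ln (r%:R + 1))) `^ (1 / 2).

Let nR : (0 : R) < n%:R. Proof. by rewrite ltr0n; lia. Qed.
Let rR : (0 : R) < r%:R. Proof. by rewrite ltr0n. Qed.
Let lnn : 0 < ln (n%:R : R). Proof. by rewrite ln_gt0// ltr1n (leq_trans _ n34). Qed.
Let lnr : 0 < ln (r%:R + 1 : R). Proof. by rewrite ln_gt0// ltrDr. Qed.
Let C30 : 0 < C3. Proof. by rewrite C3E; lra. Qed.
Let Q0 : 0 < Q.
Proof. by rewrite divr_gt0 ?mulr_gt0. Qed.

Lemma bound_gt0 : 0 < B.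
Proof.
rewrite mulr_gt0 ?powR_gt0//; first by rewrite divr_gt0 ?powR_gt0.
by rewrite divr_gt0 ?mulr_gt0.
Qed.

(** The r-th root of the moment bound produces b^(1/r). If k(h) > 0 then b >= 1, so 1/r <= 2 lambda
    permits the exponent 2 lambda, the one that matches r(h)^2. *)
Let count_le h : h != 0 ->
  (k h)%:R <= n%:R `^ r%:R^-1 * Q * (4 * M * rho h / n%:R) `^ (2 * lambda).
Proof.
move=> h0; set b := 4 * M * rho h / n%:R.
have [k0|k0] := posnP (k h); first by rewrite k0; apply: mulr_ge0 (powR_ge0 _ _);
  apply: mulr_ge0 (powR_ge0 _ _) (ltW Q0).
have [Fk /(_ k0) nk] := zP h0.
have b1 : 1 <= b.
  rewrite /b ler_pdivlMr// mul1r -mulrA mulrC -ler_pdivrMr//.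
have b0 : 0 <= b by exact: le_trans ler01 b1.
have H : (k h)%:R ^+ r <= n%:R * Q ^+ r * b.
  have := @expn_le_threshold R r (k h) r0; rewrite -C3E -/Q => T; apply: (le_trans T).
  rewrite [leRHS](_ : _ = 4 * Q ^+ r * (M * rho h)); last by rewrite /b; field; rewrite gt_eqF.
  by rewrite ler_pM2l// mulr_gt0// exprn_gt0.
have E (x : R) : 0 <= x -> (x ^+ r) `^ r%:R^-1 = x.
  by move=> x0; rewrite -powR_mulrn// -powRrM divff ?gt_eqF// powRr1.
have {}H : (k h)%:R <= n%:R `^ r%:R^-1 * Q * b `^ r%:R^-1.
  have Qr0 : 0 <= Q ^+ r by exact: exprn_ge0 _ (ltW Q0).
  rewrite -[leLHS]E// -[X in _ * X * _]E ?(ltW Q0)//.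
  rewrite -(powRM _ (ltW nR) Qr0) -(powRM _ (mulr_ge0 (ltW nR) Qr0) b0).
  apply: ge0_ler_powR => //; rewrite ?nnegrE ?invr_ge0 ?exprn_ge0 ?ler0n//.
  exact: mulr_ge0 (mulr_ge0 (ltW nR) (exprn_ge0 _ (ltW Q0))) b0.
apply: (le_trans H); apply: ler_wpM2l; first exact: mulr_ge0 (powR_ge0 _ _) (ltW Q0).
apply: ler_powR => //; move: lr; rewrite -[r%:R^-1]div1r !ler_pdivrMr ?mulr_gt0//.
by rewrite mulrC.
Qed.

(** In the square of B, n^(-2 lambda) joins the power 2 lambda of 4 M rho(h), and n^(-(r-1)/r)
    becomes n^(1/r) / n. *)
Let boundE h : (B * (4 * M) `^ lambda) ^+ 2 * rweight gamma alpha h ^+ 2 =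
  n%:R `^ r%:R^-1 * Q * (4 * M * rho h / n%:R) `^ (2 * lambda) * (ln n%:R / (C1 * n%:R)).
Proof.
have w0 : 0 < rweight gamma alpha h by exact: rweight_gt0.
have sq (x a : R) : 0 <= x -> (x `^ a) ^+ 2 = x `^ (2 * a).
  by move=> x0; rewrite -powR_mulrn ?powR_ge0// -powRrM mulrC.
have M4 : 0 <= 4 * M by rewrite mulr_ge0.
have rho0 : 0 <= rho h by exact: powR_ge0.
have rhoE : rho h `^ (2 * lambda) = rweight gamma alpha h ^+ 2.
  rewrite /rho -powRrM -powR_mulrn ?(ltW w0)//; congr (_ `^ _); field; rewrite gt_eqF//.
have nE : (n%:R `^ (lambda + (r%:R - 1) / (2 * r%:R))) ^+ 2 =
    n%:R `^ (2 * lambda) * n%:R / n%:R `^ r%:R^-1 :> R.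
  rewrite sq ?(ltW nR)// -powRN -[X in _ * X * _](@powRr1 R n%:R) ?(ltW nR)//.
  have pD (a b : R) : n%:R `^ a * n%:R `^ b = n%:R `^ (a + b) :> R.
    by rewrite powRD//; apply/implyP => _; rewrite gt_eqF.
  rewrite !pD.
  by congr (_ `^ _); field; rewrite gt_eqF.
have XE : ((C3 * r%:R * ln n%:R / (C1 * ln (r%:R + 1))) `^ (1 / 2)) ^+ 2 = Q * (ln n%:R / C1).
  rewrite sq; last by rewrite divr_ge0 ?mulr_ge0 ?(ltW lnn) ?(ltW lnr) ?(ltW C10) ?(ltW C30) ?(ltW rR).
  rewrite (_ : 2 * (1 / 2) = 1) ?powRr1; last by field.
    by rewrite /Q; field; rewrite !gt_eqF.
  by rewrite divr_ge0 ?mulr_ge0 ?(ltW lnn) ?(ltW lnr) ?(ltW C10) ?(ltW C30) ?(ltW rR).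
rewrite (powRM _ (mulr_ge0 M4 rho0)) ?invr_ge0 ?(ltW nR)// (powRM _ M4 rho0) rhoE.
have -> : (n%:R^-1) `^ (2 * lambda) = (n%:R `^ (2 * lambda))^-1 :> R.
  by rewrite -powRN -powR_inv1 ?(ltW nR)// -powRrM mulN1r.
rewrite /B !exprMn exprVn nE XE sq// expr1n.
field; rewrite !gt_eqF ?powR_gt0//.
Qed.

Lemma rms_error_bound :
  (rms_error gamma alpha (ran_pr_sh_prob R d n) (@ran_pr_sh R d z) <= (B * (4 * M) `^ lambda)%:E)%E.
Proof.
have s0 : (0 < size s)%N.
  by rewrite -(ltr_nat R); apply: lt_le_trans C1s; rewrite mulr_gt0// divr_gt0.
apply: rms_error_le => //.
- by rewrite mulr_ge0 ?powR_ge0 ?(ltW bound_gt0).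
- by move=> h; exact: rweight_gt0.
move=> h h0; rewrite boundE ler_pdivrMr ?ltr0n// -[leRHS]mulrA.
apply: (le_trans (count_le h0)); apply: ler_peMr.
  exact: mulr_ge0 (mulr_ge0 (powR_ge0 _ _) (ltW Q0)) (powR_ge0 _ _).
(* What remains is 1 <= |P_n| ln n / (C_1 n), the lower prime-counting bound. *)
have Cn0 : 0 < C1 * n%:R by exact: mulr_gt0.
by rewrite mulrC -ler_pdivrMr ?divr_gt0// mul1r invf_div -mulrA.
Qed.

End final_bound.

(** Binding [K] before d and n expresses independence of the dimension; binding z before lambda and
    r makes one vector serve all of them. *)
Theorem theorem1 (R : realType) (alpha : R) (gamma : set nat -> R)
  (alpha_gt0 : 0 < alpha) (gamma_gt0 : forall u : set nat, 0 < gamma u) :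
  exists K : R -> R,
  forall (C1 C2 : R) (n0 : nat), 0 < C1 -> 0 < C2 -> (2 <= n0)%N ->
  (forall m : nat, (n0 <= m)%N -> prime_count_bounds C1 C2 m) ->
  forall d n : nat, (0 < d)%N -> (n0 <= n)%N ->
  expR (6 * C2) <= n%:R -> 34 < expR (6 * C2) ->
  exists z : 'rV[int]_d,
    (forall j : 'I_d,
       0 <= z 0 j < (\prod_(p <- primes_upper_half n) p)%N%:Z) /\
    forall (lambda : R) (r : nat),
      0 < lambda -> lambda < alpha -> (0 < r)%N -> 1 / (2 * lambda) <= r%:R ->
      let C3 : R := 792 / 1000 in
      let B : R :=
        1 / n%:R `^ (lambda + (r%:R - 1) / (2 * r%:R))
        * (C3 * r%:R * ln n%:R / (C1 * ln (r%:R + 1))) `^ (1 / 2) in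
      let e : \bar R :=
        rms_error gamma alpha (ran_pr_sh_prob R d n) (@ran_pr_sh R d z) in
      (e <= B%:E * (4%:E * mu_sum gamma alpha d lambda) `^ lambda)%E /\
      ((weight_sum gamma alpha lambda < +oo)%E -> (e <= (B * K lambda)%:E)%E).
Proof.
exists (fun lambda => (4 * fine (weight_sum gamma alpha lambda)) `^ lambda).
move=> C1 C2 n0 C10 C20 n02 Hpc d n d0 n0n en e34.
have n34 : (34 < n)%N by rewrite -(ltr_nat R); exact: lt_le_trans en.
have /andP[C1s C2s] := Hpc n n0n.
have nR : (0 : R) < n%:R by rewrite ltr0n; lia.
have lnn : 0 < ln (n%:R : R) by rewrite ln_gt0// ltr1n; lia.
(* n >= e^(6 C_2) means 6 C_2 <= ln n, so 6 |P_n| <= 6 C_2 n / ln n <= n. *)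
have mn : (6 * size (primes_upper_half n) <= n)%N.
  rewrite -(ler_nat R) natrM; apply: (@le_trans _ _ (6 * (C2 * (n%:R / ln n%:R)))).
    by rewrite ler_pM2l.
  rewrite !mulrA ler_pdivrMr// mulrC ler_pM2l//.
  by rewrite -[leLHS]expRK ler_ln ?posrE ?expR_gt0.
have [z [zN zP]] := good_vector d gamma_gt0 alpha_gt0 n34 mn.
exists z; split => // lambda r l0 la r0 lr C3 B e.
have B0 : 0 < B by apply: bound_gt0.
have mu0 : (0 <= mu_sum gamma alpha d lambda)%E.
  by apply: esum_ge0 => h _; rewrite lee_fin powR_ge0.
(* Both claims are instances: M is mu itself for the first, the weight sum for the second. *)
have main (M : R) : (mu_sum gamma alpha d lambda <= M%:E)%E -> (e <= (B * (4 * M) `^ lambda)%:E)%E.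
  move=> muM; apply: rms_error_bound => //.
    by rewrite -lee_fin; exact: le_trans muM.
  by move=> h h0; exact: zP muM h h0.
split.
  have [mufin|] := boolP (mu_sum gamma alpha d lambda \is a fin_num).
    rewrite -(fineK mufin) -EFinM; apply: main.
    by rewrite fineK.
  (* For infinite mu the right-hand side is +oo. *)
  rewrite ge0_fin_numE// -leNgt leye_eq => /eqP ->.
  by rewrite gt0_muley ?lte_fin// poweRyr ?gt_eqF// gt0_muley ?lte_fin// leey.
move=> wfin; apply: main; rewrite fineK; first exact: mu_sum_le_weight_sum.
rewrite ge0_fin_numE//; apply: esum_ge0 => u _;
  rewrite lee_fin mulr_ge0 ?powR_ge0// exprn_ge0// mulr_ge0//.
apply: le_trans (@zeta_ge R (alpha / lambda) 1 _); first by rewrite big_geq.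
by rewrite ltr_pdivlMr// mul1r.
Qed.
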